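(* Let $M=(m_{ij})_{1\le i,j\le l}$ be the Cartan matrix of $\mathfrak{g}$. Then $$\chi_{W(\Lambda_0)}(x_1,\dots,x_l;q)=\sum_{\mathbf{n}=(n_1,\dots,n_l)}\frac{q^{\frac{\mathbf{n}M\mathbf{n}^T}{2}}}{(q)_{n_1}\cdots(q)_{n_l}}x_1^{n_1}\cdots x_l^{n_l}$$ (the sum over all $\mathbf{n}$ with each $n_j\ge0$ an integer). Moreover, for $i=1,\dots,l$, $$\chi'_{W(\lambda_i)}(x_1,\dots,x_l;q)=\sum_{\mathbf{n}=(n_1,\dots,n_l)}\frac{q^{\frac{\mathbf{n}M\mathbf{n}^T+2n_i}{2}}}{(q)_{n_1}\cdots(q)_{n_l}}x_1^{n_1}\cdots x_l^{n_l}.$$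
   Context: Let $\mathfrak{g}$ be a finite-dimensional complex simple Lie algebra of type $A$, $D$ or $E$ of rank $l$, with Cartan subalgebra $\mathfrak{h}$, simple roots $\alpha_1,\dots,\alpha_l$, set of roots $\Delta$, set of positive roots $\Delta_+$, and invariant form $\langle\cdot,\cdot\rangle$ normalized so that $\langle\alpha,\alpha\rangle=2$ for $\alpha\in\Delta$; identify $\mathfrak{h}$ with $\mathfrak{h}^*$ via this form. Let $\lambda_1,\dots,\lambda_l$ be the fundamental weights ($\langle\lambda_i,\alpha_j\rangle=\delta_{ij}$), $\lambda_0=0$, $Q=\sum_i\mathbb{Z}\alpha_i$ and $P=\sum_i\mathbb{Z}\lambda_i$ the root and weight lattices. For each root $\alpha$ let $x_\alpha$ be a root vector (normalized below). Let $\widehat{\mathfrak{g}}=\mathfrak{g}\otimes\mathbb{C}[t,t^{-1}]\oplus\mathbb{C}\mathbf{k}$, $\mathbf{k}$ central, $[x\otimes t^m,y\otimes t^n]=[x,y]\otimes t^{m+n}+m\langle x,y\rangle\delta_{m+n,0}\mathbf{k}$. Let $\mathfrak{n}=\coprod_{\alpha\in\Delta_+}\mathbb{C}x_\alpha$ and $\bar{\mathfrak{n}}=\mathfrak{n}\otimes\mathbb{C}[t,t^{-1}]$. The module $V_P$. Fix $s>0$ and a 2-cocycle $\epsilon:P\times P\to\mathbb{C}^\times$ with values in the $s$-th roots of unity, normalized by $\epsilon(\alpha,0)=\epsilon(0,\alpha)=1$, whose commutator map $c(\alpha,\beta)=\epsilon(\alpha,\beta)/\epsilon(\beta,\alpha)$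 (alternating and $\mathbb{Z}$-bilinear) satisfies $c(\alpha,\beta)=(-1)^{\langle\alpha,\beta\rangle}$ for $\alpha,\beta\in Q$; such data exist. Let $M(1)=S(\mathfrak{h}\otimes t^{-1}\mathbb{C}[t^{-1}])$ be the level one Fock module for $\widehat{\mathfrak{h}}=\mathfrak{h}\otimes\mathbb{C}[t,t^{-1}]\oplus\mathbb{C}\mathbf{k}$ on which $\mathfrak{h}\otimes\mathbb{C}[t]$ annihilates the vacuum, and $V_P=M(1)\otimes\mathbb{C}[P]$, where $\mathbb{C}[P]$ has basis $e^\beta$, $\beta\in P$. For $h\in\mathfrak{h}$, $h(n)$ ($n\ne0$) acts on the factor $M(1)$ and $h(0)(v\otimes e^\beta)=\langle h,\beta\rangle v\otimes e^\beta$. For $\lambda\in P$ put $e_\lambda(v\otimes e^\beta)=\epsilon(\lambda,\beta)v\otimes e^{\lambda+\beta}$, $x^\lambda(v\otimes e^\beta)=x^{\langle\lambda,\beta\rangle}v\otimes e^\beta$, $E^\pm(-\lambda,x)=\exp\left(\sum_{\pm n>0}\frac{-\lambda(n)}{n}x^{-n}\right)$ and $Y(e^\lambda,x)=E^-(-\lambda,x)E^+(-\lambda,x)e_\lambda x^\lambda$. For $\alpha\in\Delta$ write $Y(e^\alpha,x)=\sum_{m\in\mathbb{Z}}x_\alpha(m)x^{-m-1}$. With suitably normalized root vectors $x_\alpha$, these operators together with the $\widehat{\mathfrak{h}}$-action make $V_P$ a $\widehat{\mathfrak{g}}$-module of level one in which $x_\alpha\otimes t^m$ acts as $x_\alpha(m)$;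 this normalization is fixed. Write $e^\lambda$ for $1\otimes e^\lambda$. For $i=0,\dots,l$ the principal-like subspace is $W(\lambda_i)=U(\bar{\mathfrak{n}})\cdot e^{\lambda_i}\subset V_P$. The basic module $L(\Lambda_0)$ is identified with $V_Q=M(1)\otimes\mathbb{C}[Q]\subset V_P$ with highest weight vector $e^0$, and its principal subspace is $W(\Lambda_0)=W(\lambda_0)$. Gradings. The Virasoro operator $L(0)$ acts on $h_1(-n_1)\cdots h_k(-n_k)\otimes e^\lambda$ ($h_j\in\mathfrak{h}$, $n_j\ge1$) as the scalar $n_1+\cdots+n_k+\frac12\langle\lambda,\lambda\rangle$, and $\lambda_j=\lambda_j(0)$ acts on it as the scalar $\langle\lambda_j,\lambda\rangle$; these operators preserve each $W(\lambda_i)$. With commuting formal variables $x_1,\dots,x_l,q$, define $$\chi_{W(\lambda_i)}(x_1,\dots,x_l;q)=\mathrm{tr}_{W(\lambda_i)}\,x_1^{\lambda_1}\cdots x_l^{\lambda_l}q^{L(0)}$$ for $i=0,\dots,l$ (so $\chi_{W(\Lambda_0)}=\chi_{W(\lambda_0)}$), and for $i=1,\dots,l$ $$\chi'_{W(\lambda_i)}(x_1,\dots,x_l;q)=x_1^{-\langle\lambda_i,\lambda_1\rangle}\cdots x_l^{-\langle\lambda_i,\lambda_l\rangle}q^{-\langle\lambda_i,\lambda_i\rangle/2}\chi_{W(\lambda_i)}(x_1,\dots,x_l;q)\in\mathbb{C}[[x_1,\dots,x_l,q]].$$ For a nonnegative integer $n$, $(q)_n=(1-q)\cdots(1-q^n)$.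 *)

(* Defs.v *)
From HB Require Import structures.
From mathcomp Require Import all_boot all_order all_algebra perm finmap.
From mathcomp Require Import boolp classical_sets fsbigop reals complex.
From mathcomp Require Import multinomials.monalg.

Set Implicit Arguments.
Unset Strict Implicit.
Unset Printing Implicit Defensive.

Import Order.TTheory GRing.Theory Num.Theory.
Local Open Scope classical_set_scope.
Local Open Scope ring_scope.

(** * Finite-dimensional Lie algebras *)

Record lieAlgebra (F : fieldType) := LieAlgebra {
  lie_car :> vectType F;
  brk : lie_car -> lie_car -> lie_car;
  brkDl : forall (a : F) x y z, brk (a *: x + y) z = a *: brk x z + brk y z;
  brkDr : forall (a : F) x y z, brk z (a *: x + y) = a *: brk z x + brk z y;
  brkxx : forall x, brk x x = 0;
  brk_jacobi : forall x y z,
    brk x (brk y z) + brk y (brk z x) + brk z (brk x y) = 0 }.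

Section LieTheory.
Variables (F : fieldType) (g : lieAlgebra F).
Implicit Types (H I : {vspace g}) (x y z h : g).

Definition lie_ideal I := forall x y, y \in I -> brk x y \in I.

Definition lie_simple :=
  (exists x y, brk x y != 0) /\
  forall I, lie_ideal I -> I = 0%VS \/ I = fullv.

Definition lie_subalgebra H := forall x y, x \in H -> y \in H -> brk x y \in H.

(* The n-th term of the lower central series of H is spanned by the brackets
   [s_1, [s_2, ... [s_n, y]]] with entries in H. *)
Definition lie_nilpotent H :=
  exists n, forall (s : seq g) y,
    size s = n -> {subset s <= H} -> y \in H -> foldr (@brk F g) y s = 0.

Definition lie_self_normalizing H :=
  forall x, (forall y, y \in H -> brk x y \in H) -> x \in H.

Definition cartan_subalgebra H :=
  [/\ lie_subalgebra H, lie_nilpotent H & lie_self_normalizing H].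

Record invariant_form (form : g -> g -> F) : Prop := {
  formDl : forall (a : F) x y z, form (a *: x + y) z = a * form x z + form y z;
  formC : forall x y, form x y = form y x;
  form_inv : forall x y z, form (brk x y) z = form x (brk y z);
  form_nondeg : forall x, (forall y, form x y = 0) -> x = 0 }.

Variables (H : {vspace g}) (form : g -> g -> F).

Definition root_vector (a x : g) :=
  x != 0 /\ forall h, h \in H -> brk h x = form a h *: x.

(* H is identified with its dual by means of form, so that roots are elements
   of H. *)
Definition lie_root : set g :=
  [set a | [/\ a \in H, a != 0 & exists x, root_vector a x]].

Variables (l : nat) (alpha : 'I_l -> g).

Definition nonneg_comb : set g :=
  [set a | exists c : 'I_l -> nat, a = \sum_i (c i)%:R *: alpha i].

Definition simple_roots :=
  [/\ basis_of H [tuple alpha i | i < l],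
      forall i, lie_root (alpha i)
    & forall a, lie_root a -> nonneg_comb a \/ nonneg_comb (- a)].

Definition pos_root : set g := lie_root `&` nonneg_comb.

Definition is_cartan_matrix (M : 'M[int]_l) := forall i j,
  (M i j)%:~R = 2 * form (alpha i) (alpha j) / form (alpha j) (alpha j).

Definition fundamental_weights (lam : 'I_l -> g) :=
  forall i, lam i \in H /\ forall j, form (lam i) (alpha j) = (i == j)%:R.

(* The subspace spanned by the vectors x a, for a a positive root. *)
Definition nplus (x : g -> g) : set g :=
  [set y | exists2 s : seq g, (forall a, a \in s -> pos_root a) &
           exists c : g -> F, y = \sum_(a <- s) c a *: x a].

End LieTheory.

(** * Cartan matrices of type A, D, E *)

(* Edges i -- j, i < j, of the Dynkin diagrams with vertices 0, ..., l - 1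
   numbered as in Bourbaki (shifted by one). *)
Definition edgeA (i j : nat) : bool := j == i.+1.
Definition edgeD (l i j : nat) : bool :=
  ((j == i.+1) && (j < l.-1)%N) || ((i.+3 == l) && (j == i.+2)).
Definition edgeE (i j : nat) : bool :=
  [|| (i == 0) && (j == 2), (i == 1) && (j == 3) | (2 <= i) && (j == i.+1)]%N.

Definition dynkin_matrix (l : nat) (e : nat -> nat -> bool) : 'M[int]_l :=
  \matrix_(i, j) if i == j then 2 else if e i j || e j i then -1 else 0.

Definition typeADE (l : nat) (M : 'M[int]_l) :=
  exists s : 'S_l,
    let N := \matrix_(i, j) M (s i) (s j) in
    [\/ (1 <= l)%N /\ N = dynkin_matrix l edgeA,
        (4 <= l)%N /\ N = dynkin_matrix l (edgeD l)
      | (6 <= l <= 8)%N /\ N = dynkin_matrix l edgeE].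

(** * The space V_P *)

Section VP.
Variables (F : numClosedFieldType) (g : lieAlgebra F) (form : g -> g -> F).
Variables (l : nat) (alpha lam : 'I_l -> g).

(* P is identified with Z^l by means of its basis lam. *)
Definition lattice := 'rV[int]_l.

Definition wt (b : lattice) : g := \sum_i (b 0 i)%:~R *: lam i.

Definition pairP (b c : lattice) : F := form (wt b) (wt c).

(* For H with basis alpha, S(H (x) t^-1 C[t^-1]) is the polynomial ring in the
   alpha_i (x) t^-n, n > 0. Here the monomial variable (i, k) is
   alpha_i (x) t^-(k+1), and the pair (m, b) is the basis vector
   m (x) e^b of V_P. *)
Definition fock_monom := {cmonom ('I_l * nat)%type}.
Definition VPbasis : choiceType := (fock_monom * lattice)%type.
Definition VP := {malg F[VPbasis]}.

Definition linext (f : VPbasis -> VP) (v : VP) : VP :=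
  \sum_(k <- msupp v) v@_k *: f k.

Definition evec (b : lattice) : VP := << ((mone : fock_monom), b) : VPbasis >>.

(* h(n). For n = -(k+1) this is multiplication by
   h (x) t^n = \sum_i <h, lam_i> alpha_i (x) t^n; for n = k+1 it is the
   derivation of the polynomial ring with h(n) (alpha_i (x) t^-n) =
   n <h, alpha_i>. *)
Definition heis (h : g) (n : int) : VP -> VP := linext (fun p =>
  match n with
  | Posz 0 => form h (wt p.2) *: << p >>
  | Posz k.+1 => \sum_(i < l) (k.+1%:R * form h (alpha i) * (p.1 (i, k))%:R) *:
                   << (divcm p.1 (ucm (i, k)), p.2) : VPbasis >>
  | Negz k => \sum_(i < l) form h (lam i) *:
                << (mmul p.1 (ucm (i, k)), p.2) : VPbasis >>
  end).

(* Power series in one variable with coefficients operators on VP. *)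
Definition opseries := nat -> VP -> VP.

Definition op1 : opseries := fun n v => if n == 0%N then v else 0.

Definition opmul (A B : opseries) : opseries :=
  fun n v => \sum_(i < n.+1) A i (B (n - i)%N v).

Definition opexpn (A : opseries) (k : nat) : opseries := iter k (opmul A) op1.

(* The exponential of a series A with A 0 = 0: the terms A^k / k! with k > n
   do not contribute to the coefficient of degree n. *)
Definition opexp (A : opseries) : opseries :=
  fun n v => \sum_(k < n.+1) (k`!%:R)^-1 *: opexpn A k n v.

(* E^-(-b, x) = \sum_n (Eminus b n) x^n and
   E^+(-b, x) = \sum_n (Eplus b n) x^-n. *)
Definition Eminus (b : lattice) : opseries := opexp (fun n v =>
  if n == 0%N then 0 else - (- n%:R)^-1 *: heis (wt b) (- n%:Z) v).
Definition Eplus (b : lattice) : opseries := opexp (fun n v =>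
  if n == 0%N then 0 else - (n%:R)^-1 *: heis (wt b) n%:Z v).

Variable eps : lattice -> lattice -> F.

Definition eop (c : lattice) : VP -> VP := linext (fun p =>
  eps c p.2 *: << (p.1, c + p.2) : VPbasis >>).

(* The coefficient of x^r in Y(e^c, x). On a basis vector the sum has finite
   support, Eplus c j being zero there for j large. *)
Definition Ycoef (c : lattice) (r : F) : VP -> VP := linext (fun p =>
  \sum_(ij \in [set ij : nat * nat | ij.1%:R - ij.2%:R + pairP c p.2 = r])
    Eminus c ij.1 (Eplus c ij.2 (eop c << p >>))).

Definition Ymode (c : lattice) (m : int) : VP -> VP := Ycoef c (- m%:~R - 1).

Definition L0 : VP -> VP := linext (fun p =>
  ((\sum_(k <- finsupp (cmonom_val p.1)) k.2.+1 * p.1 k)%N%:R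
     + pairP p.2 p.2 / 2) *: << p >>).

Record cocycle (s : nat) : Prop := {
  eps_root : forall a b, eps a b ^+ s = 1;
  eps_cocycle : forall a b c, eps a b * eps (a + b) c = eps b c * eps a (b + c);
  eps0l : forall a, eps 0 a = 1;
  eps0r : forall a, eps a 0 = 1;
  eps_bilin : forall a b c, eps (a + b) c / eps c (a + b) =
    (eps a c / eps c a) * (eps b c / eps c b) }.

Definition root_lattice : set lattice :=
  [set b | exists c : 'I_l -> int, wt b = \sum_i (c i)%:~R *: alpha i].

Definition commutator_on_Q := forall a b, root_lattice a -> root_lattice b ->
  exists2 k : int, pairP a b = k%:~R & eps a b / eps b a = (-1) ^ k.

Variables (H : {vspace g}) (rho : g -> int -> VP -> VP).

(* rho y n is the action of y (x) t^n, the central element acting as 1. *)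
Record affine_module : Prop := {
  rhoDl : forall a y z n v, rho (a *: y + z) n v = a *: rho y n v + rho z n v;
  rhoDr : forall a y n u v, rho y n (a *: u + v) = a *: rho y n u + rho y n v;
  rho_brk : forall y z m n v,
    rho y m (rho z n v) - rho z n (rho y m v) =
    rho (brk y z) (m + n) v
      + (if m + n == 0 then (m%:~R * form y z) *: v else 0) }.

Definition rho_heis := forall h n v, h \in H -> rho h n v = heis h n v.

(* x is a choice of root vectors, rho (x a) m being the operator x_a(m). *)
Definition normalized_root_vectors (x : g -> g) :=
  (forall a, lie_root H form a -> root_vector H form a (x a)) /\
  (forall b m v, lie_root H form (wt b) -> rho (x (wt b)) m v = Ymode b m v).

(* The U(n (x) C[t, t^-1])-submodule generated by v0. *)
Inductive principal_subspace (n : set g) (v0 : VP) : VP -> Prop :=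
| ps_gen : principal_subspace n v0 v0
| ps_lin : forall c u v, principal_subspace n v0 u ->
    principal_subspace n v0 v -> principal_subspace n v0 (c *: u + v)
| ps_act : forall y m v, n y -> principal_subspace n v0 v ->
    principal_subspace n v0 (rho y m v).

(** * Characters *)

(* A formal series \sum f mu N x_1^(mu_1) ... x_l^(mu_l) q^N, the exponents
   being arbitrary scalars. *)
Definition fseries := 'rV[F]_l -> F -> F.

Definition fmonmul (mu0 : 'rV[F]_l) (N0 : F) (f : fseries) : fseries :=
  fun mu N => f (mu - mu0) (N - N0).

Definition weight_space (W : set VP) (mu : 'rV[F]_l) (N : F) : set VP :=
  [set v | [/\ W v, L0 v = N *: v & forall j, heis (lam j) 0 v = mu 0 j *: v]].

Definition has_dim (S : set VP) (d : nat) := exists b : 'I_d -> VP,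
  (forall c : 'rV[F]_d, S (\sum_i c 0 i *: b i)) /\
  forall v, S v -> exists! c : 'rV[F]_d, v = \sum_i c 0 i *: b i.

(* 0 if S is not of finite dimension. *)
Definition dimension (S : set VP) : nat := xget 0%N (has_dim S).

(* The trace on W of x_1^(lam_1) ... x_l^(lam_l) q^L(0). *)
Definition character (W : set VP) : fseries :=
  fun mu N => (dimension (weight_space W mu N))%:R.

Definition character_defined (W : set VP) :=
  forall mu N, exists d, has_dim (weight_space W mu N) d.

End VP.

(** * The fermionic sums *)

Section Fermionic.
Variables (F : fieldType) (l : nat).

(* The first n coefficients of the power series 1 / p, for p`_0 != 0. *)
Fixpoint inv_coefs (p : {poly F}) (n : nat) : seq F :=
  if n is k.+1 then
    let s := inv_coefs p k in
    rcons s ((p`_0)^-1 * ((k == 0%N)%:R - \sum_(j < k) p`_(k - j) * s`_j))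
  else [::].

Definition inv_coef (p : {poly F}) (k : nat) : F := (inv_coefs p k.+1)`_k.

Lemma size_inv_coefs p n : size (inv_coefs p n) = n.
Proof. by elim: n => //= n IH; rewrite size_rcons IH. Qed.

Lemma nth_inv_coefs p n k : (k < n)%N -> (inv_coefs p n)`_k = inv_coef p k.
Proof.
elim: n => // n IH; rewrite ltnS leq_eqVlt => /orP [/eqP -> //|kn].
by rewrite /= nth_rcons size_inv_coefs kn IH.
Qed.

Lemma inv_coefP (p : {poly F}) k : p`_0 != 0 ->
  \sum_(j < k.+1) p`_(k - j) * inv_coef p j = (k == 0%N)%:R.
Proof.
move=> p0; rewrite big_ord_recr /= subnn {2}/inv_coef /= nth_rcons.
rewrite size_inv_coefs ltnn eqxx mulVKf // addrC -addrA -[RHS]addr0.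
congr (_ + _); rewrite addrC; apply/eqP; rewrite subr_eq0; apply/eqP.
by apply: eq_bigr => j _; rewrite nth_inv_coefs.
Qed.

Definition qpoch (n : nat) : {poly F} := \prod_(1 <= k < n.+1) (1 - 'X^k).

(* The term x^n q^E / ((q)_(n_1) ... (q)_(n_l)), E being allowed to be any
   scalar. *)
Definition fermionic_term (n : 'rV[nat]_l) (E : F) : 'rV[F]_l -> F -> F :=
  fun mu N =>
    if mu == map_mx (fun k => k%:R) n then
      \sum_(k \in [set k : nat | N = E + k%:R])
         inv_coef (\prod_j qpoch (n 0 j)) k
    else 0.

Definition fermionic_sum (E : 'rV[nat]_l -> F) : 'rV[F]_l -> F -> F :=
  fun mu N => \sum_(n \in [set: 'rV[nat]_l]) fermionic_term n (E n) mu N.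

(* n M n^T *)
Definition quad (M : 'M[int]_l) (n : 'rV[nat]_l) : F :=
  let z := map_mx Posz n in ((z *m M *m z^T) 0 0)%:~R.

End Fermionic.

(* Main.v *)
(** Under the identification of alpha_j(-n) with the power sums in a j-th
    alphabet, the coefficients of E^-(-alpha_j, x) are the complete homogeneous
    symmetric functions h_(j,r), which are algebraically independent generators
    of M(1). Let T_n be the span of the monomials in the h_(j,r), r > 0, of
    degree at most n_j in each color j. Then W(lambda) is the direct sum of the
    T_n e^(lambda + \sum_j n_j alpha_j).

    For beta = \sum_j c_j alpha_j, the coefficients of
    E^-(-beta, x) = \prod_j E^-(-alpha_j, x)^(c_j) lie in T_c, while
    E^+(-beta, x) is built from derivations sending h_(j,r) to multiples of
    h_(j,r-m), hence preserves every T_n: the direct sum is stable. Conversely,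
    x_(alpha_j)(m) v is, for v in T_n and a suitable m, a nonzero multiple of
    h_(j,r) v + \sum_(s > 0) h_(j,r+s) v_s with v_s in T_n of smaller weight than
    v, so induction on the weight puts h_(j,r) T_n into W(lambda).

    The h-monomials of T_n are families of partitions with at most n_j parts,
    counted by 1 / ((q)_(n_1) ... (q)_(n_l)), and
    |lambda + \sum_j n_j alpha_j|^2 / 2 accounts for the exponent of q. *)

Require Import Defs.
From HB Require Import structures.
From mathcomp Require Import all_boot all_order all_algebra perm finmap.
From mathcomp Require Import boolp classical_sets fsbigop reals complex.
From mathcomp Require Import multinomials.monalg.
From mathcomp Require Import zify ring.

Set Implicit Arguments.
Unset Strict Implicit.
Unset Printing Implicit Defensive.

Import Order.TTheory GRing.Theory Num.Theory.
Local Open Scope classical_set_scope.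
Local Open Scope ring_scope.

(** The generators alpha_j(-n) themselves give no suitable degree filtration: the coefficient of x^r
    in E^-(-alpha_j, x) has degree r in them. In the h_(j,r) it has degree one, and since h_(j,0) =
    1 the spaces T_n are cut out by upper bounds rather than by exact degrees. Exponentials are
    handled through the recursion n e_n = \sum_(0 < m <= n) A_m e_(n-m), which determines all
    coefficients in characteristic zero; product formulas, derivations and gradings then become
    inductions on n. Stability is checked uniformly for all nonnegative combinations beta of simple
    roots, whereas generation works with the simple roots alone. Independence of the h-monomials is
    a triangularity for the polynomial degree. In the count, removing 1 from each of n_j parts
    corresponds to the factor 1 - q^(n_j) of (q)_(n_j). *)

Section LinearFunctions.
Variables (F : pzRingType) (U V : lmodType F) (f : U -> V).
Hypothesis lf : linear f.

Lemma linfun0 : f 0 = 0.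
Proof. by have := lf (-1) 0 0; rewrite scaler0 addr0 scaleN1r addNr. Qed.

Lemma linfunZ c u : f (c *: u) = c *: f u.
Proof. by rewrite -[X in f X]addr0 lf linfun0 addr0. Qed.

Lemma linfunD u v : f (u + v) = f u + f v.
Proof. by rewrite -[X in f (X + _)]scale1r lf scale1r. Qed.

Lemma linfun_sum (T : Type) (r : seq T) (P : pred T) (u : T -> U) :
  f (\sum_(i <- r | P i) u i) = \sum_(i <- r | P i) f (u i).
Proof. exact: (big_morph f linfunD linfun0). Qed.

End LinearFunctions.

(** * Linear extension from a basis *)

Section LinearExtension.
Variables (F : fieldType) (K : choiceType).
Implicit Types (v : {malg F[K]}) (k : K).

Lemma malgU_scale (c : F) k : << c *g k >> = c *: << k >> :> {malg F[K]}.
Proof. by apply/malgP => k'; rewrite mcoeffZ !mcoeffU mulrnAr mulr1. Qed.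

Lemma malg_linind (P : {malg F[K]} -> Prop) :
  P 0 -> (forall c u v, P u -> P v -> P (c *: u + v)) ->
  (forall k, P << k >>) -> forall v, P v.
Proof.
move=> P0 PD PU v; rewrite [v]monalgE; elim/big_rec: _ => // k u _ Pu.
by rewrite malgU_scale; apply: PD.
Qed.

Variable V : lmodType F.

(** Convertible to [linext] when the target is [VP], so that its lemmas apply to the operators on
    V_P; a general target also allows maps between V_P, the Fock space and spaces of coordinates. *)
Definition mext (f : K -> V) v : V := \sum_(k <- msupp v) v@_k *: f k.

Lemma mext_widen f v (d : {fset K}) : (msupp v `<=` d)%fset ->
  mext f v = \sum_(k <- d) v@_k *: f k.
Proof.
move=> le; rewrite /mext (big_fset_incl _ le) // => k _ kv.
by rewrite mcoeff_outdom ?scale0r.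
Qed.

Lemma mext_is_linear f : linear (mext f).
Proof.
move=> c u v; pose d := (msupp u `|` msupp v `|` msupp (c *: u + v))%fset.
rewrite !(@mext_widen f _ d); first last.
- by rewrite /d fsubsetUr.
- by rewrite /d -fsetUA fsubsetUl.
- by rewrite /d fsetUAC fsubsetUr.
rewrite scaler_sumr -big_split /=; apply: eq_bigr => k _.
by rewrite mcoeffD mcoeffZ scalerDl scalerA.
Qed.

HB.instance Definition _ f :=
  GRing.isLinear.Build F {malg F[K]} V _ (mext f) (mext_is_linear f).

Lemma mextU f k : mext f << k >> = f k.
Proof. by rewrite /mext msuppU oner_eq0 big_seq_fset1 mcoeffUU scale1r. Qed.

Lemma linear_malg_eq (f g : {malg F[K]} -> V) : linear f -> linear g ->
  (forall k, f << k >> = g << k >>) -> f =1 g.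
Proof.
move=> lf lg fg; apply: malg_linind => [|c u v fu fv|//].
  by rewrite !linfun0.
by rewrite lf lg fu fv.
Qed.

End LinearExtension.

(** * Exponentials of commuting operators through their recursion *)

Section ExpRecursion.
Variables (F : numFieldType) (V : lmodType F).

(* The sequence e_0 = v, n e_n = \sum_(0 < m <= n) A_m e_(n - m), i.e. the
   coefficients of exp(\sum_m A_m z^m / m) v when the A_m commute. *)
Fixpoint erec_fuel (A : nat -> V -> V) (v : V) (f n : nat) : V :=
  if n is n'.+1 then
    if f is f'.+1 then
      n%:R^-1 *: \sum_(m < n) A m.+1 (erec_fuel A v f' (n' - m))
    else 0
  else v.

Definition erec A v n := erec_fuel A v n n.

(** The recursion calls every smaller index, hence the fuel; any amount of at least n yields the
    same value. *)
Lemma erec_fuelE A v f n : (n <= f)%N -> erec_fuel A v f n = erec A v n.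
Proof.
rewrite /erec; elim/ltn_ind: n f => -[|n] IH [|f] //= nf.
congr (_ *: _); apply: eq_bigr => m _; congr (A _ _).
by rewrite !IH ?ltnS ?leq_subr ?(leq_trans (leq_subr _ _)).
Qed.

Lemma erecS A v n :
  n.+1%:R *: erec A v n.+1 = \sum_(m < n.+1) A m.+1 (erec A v (n - m)).
Proof.
rewrite {1}/erec /= scalerA divff ?pnatr_eq0 // scale1r.
by apply: eq_bigr => m _; rewrite erec_fuelE ?leq_subr.
Qed.

End ExpRecursion.

Lemma big_triangle_exchange (V : nmodType) (n : nat) (G : nat -> nat -> V) :
  \sum_(i < n.+1) \sum_(m < (n - i).+1) G i m =
  \sum_(m < n.+1) \sum_(i < (n - m).+1) G i m.
Proof.
have E (H : nat -> nat -> V) : \sum_(i < n.+1) \sum_(m < (n - i).+1) H i m =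
    \sum_(i < n.+1) \sum_(m < n.+1 | (i + m <= n)%N) H i m.
  apply: eq_bigr => i _.
  have le : ((n - i).+1 <= n.+1)%N by rewrite ltnS leq_subr.
  rewrite (big_ord_widen _ (fun m => H i m) le); apply: eq_bigl => m.
  by rewrite ltnS leq_subRL // -ltnS.
rewrite (E G) (E (fun m i => G i m)) (exchange_big_dep xpredT) //=.
by apply: eq_bigr => m _; apply: eq_bigl => i; rewrite addnC.
Qed.

Section OperatorExp.
Variables (F : numClosedFieldType) (l : nat) (A : opseries F l).
Hypothesis (lA : forall m, linear (A m)).
Hypothesis (cA : forall m k v, A m (A k v) = A k (A m v)).
Hypothesis (A0 : forall v, A 0 v = 0).

Let A0r m : A m 0 = 0. Proof. exact: linfun0. Qed.
Let AZ m c v : A m (c *: v) = c *: A m v. Proof. exact: linfunZ. Qed.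
Let Asum m n (u : 'I_n -> VP F l) : A m (\sum_i u i) = \sum_i A m (u i).
Proof. exact: linfun_sum. Qed.

Lemma opexpnS k n v :
  opexpn A k.+1 n v = \sum_(i < n.+1) A i (opexpn A k (n - i)%N v).
Proof. exact: erefl. Qed.

(** The rule z (A^k)' = k (z A') A^(k-1) for the derivation z d/dz. Commutation of the coefficients
    brings the differentiated factor to the front; at k = 0 the exponent [k.-1] is harmless because
    of the factor k. *)
Lemma opexpn_deriv k n v :
  n%:R *: opexpn A k n v =
  k%:R *: \sum_(m < n.+1) m%:R *: A m (opexpn A k.-1 (n - m)%N v).
Proof.
elim: k n => [|k IH] n.
  by rewrite scale0r /opexpn /= /op1; case: n => [|n]; rewrite ?scale0r ?scaler0.
rewrite opexpnS.
rewrite [LHS]scaler_sumr.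
transitivity (\sum_(i < n.+1) (i%:R *: A i (opexpn A k (n - i)%N v) +
    k%:R *: A i (\sum_(m < (n - i).+1) m%:R *: A m (opexpn A k.-1 (n - i - m)%N v)))).
  apply: eq_bigr => i _; rewrite -[X in _ = _ + X]AZ -IH AZ -scalerDl -natrD.
  by rewrite subnKC ?leq_ord.
rewrite [LHS]big_split /= mulrSr scalerDl scale1r [LHS]addrC; congr (_ + _).
rewrite -[LHS]scaler_sumr; case: k {IH} => [|k]; first by rewrite !scale0r.
congr (_ *: _).
transitivity (\sum_(i < n.+1) \sum_(m < (n - i).+1)
    m%:R *: A i (A m (opexpn A k (n - i - m)%N v))).
  by apply: eq_bigr => i _; rewrite Asum; apply: eq_bigr => m _; rewrite AZ.
rewrite (big_triangle_exchange n
  (fun i m => m%:R *: A i (A m (opexpn A k (n - i - m)%N v)))).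
apply: eq_bigr => m _; rewrite -[LHS]scaler_sumr; congr (_ *: _).
rewrite opexpnS Asum.
by apply: eq_bigr => i _; rewrite cA subnAC.
Qed.

Lemma opexpn_low k n v : (n < k)%N -> opexpn A k n v = 0.
Proof.
elim: k n => // k IH n nk; rewrite opexpnS.
rewrite big1 // => -[[|i] /= li] _; first by rewrite A0.
by rewrite IH ?A0r //; lia.
Qed.

(** Since A has no constant term, A^k starts in degree k; hence one truncation serves for all
    coefficients of degree at most N. *)
Lemma opexp_widen N n v : (n <= N)%N ->
  opexp A n v = \sum_(k < N.+1) k`!%:R^-1 *: opexpn A k n v.
Proof.
move=> nN; have le : (n.+1 <= N.+1)%N by [].
rewrite /opexp (big_ord_widen _ (fun k => k`!%:R^-1 *: opexpn A k n v) le).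
rewrite [RHS](bigID (fun k : 'I_ _ => (k < n.+1)%N)) /= [X in _ = _ + X]big1 ?addr0 //.
by move=> i; rewrite -leqNgt => ni; rewrite opexpn_low ?scaler0.
Qed.

Lemma opexp0 v : opexp A 0 v = v.
Proof. by rewrite /opexp big_ord_recl big_ord0 fact0 invr1 scale1r addr0. Qed.

(** The differential equation z E' = (z A') E of E = exp A. Together with [opexp0] it determines E
    and replaces the definition by powers from here on. *)
Lemma opexp_deriv n v : n.+1%:R *: opexp A n.+1 v =
  \sum_(m < n.+1) m.+1%:R *: A m.+1 (opexp A (n - m)%N v).
Proof.
rewrite [in LHS]/opexp [LHS]scaler_sumr [LHS]big_ord_recl.
rewrite [opexpn A _ _ _ in X in X + _](_ : _ = 0) // !scaler0 add0r.
transitivity (\sum_(k < n.+1) \sum_(m < n.+2)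
   k`!%:R^-1 *: (m%:R *: A m (opexpn A k (n.+1 - m)%N v))).
  apply: eq_bigr => k _; rewrite lift0 scalerA mulrC -scalerA.
  have -> : (k.+1)`!%:R^-1 = k`!%:R^-1 * k.+1%:R^-1 :> F.
    by rewrite factS natrM invfM mulrC.
  rewrite -[LHS]scalerA (opexpn_deriv k.+1 n.+1 v) (scalerA k.+1%:R^-1 k.+1%:R).
  have k0 : k.+1%:R != 0 :> F by rewrite pnatr_eq0.
  rewrite (mulVf k0) scale1r.
  by rewrite [LHS]scaler_sumr.
rewrite [LHS]exchange_big [LHS]big_ord_recl /= [X in X + _]big1; last first.
  by move=> k _; rewrite scale0r scaler0.
rewrite add0r; apply: eq_bigr => m _; rewrite /bump /= add1n subSS.
rewrite (@opexp_widen n) ?leq_subr // Asum [RHS]scaler_sumr.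
apply: eq_bigr => k _; rewrite AZ [LHS]scalerA [RHS]scalerA.
by rewrite mulrC.
Qed.

End OperatorExp.

(** * Supports and gradings in monoid algebras *)

Section MonomialWeight.
Variable I : choiceType.
Implicit Types (m : {cmonom I}) (w : I -> nat) (v : I).

(** One weighted degree for three purposes: the degree in a color, the conformal weight, and the
    exponent of a single variable ([cmwt_pred1]). *)
Definition cmwt w m : nat := (\sum_(v <- finsupp (cmonom_val m)) w v * m v)%N.

Lemma cmwt_widen w m (d : {fset I}) : (finsupp (cmonom_val m) `<=` d)%fset ->
  cmwt w m = (\sum_(v <- d) w v * m v)%N.
Proof.
move=> le; rewrite /cmwt (big_fset_incl _ le) // => v _.
by rewrite memNfinsupp => /eqP ->; rewrite muln0.
Qed.

Lemma cmwt1 w : cmwt w mone = 0%N.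
Proof. by rewrite /cmwt mdom1 big_seq_fset0. Qed.

Lemma cmwtU w v : cmwt w (ucm v) = w v.
Proof. by rewrite /cmwt mdomU big_seq_fset1 cmUU muln1. Qed.

Lemma cmwtM w m1 m2 : cmwt w (mmul m1 m2) = (cmwt w m1 + cmwt w m2)%N.
Proof.
pose d := (finsupp (cmonom_val m1) `|` finsupp (cmonom_val m2))%fset.
rewrite !(@cmwt_widen _ _ d) ?mdomD ?fsubset_refl ?fsubsetUl ?fsubsetUr //.
by rewrite -big_split /=; apply: eq_bigr => v _; rewrite cmM mulnDr.
Qed.

Lemma cmwt_gt0P w m : (0 < cmwt w m)%N ->
  exists2 v, (0 < w v)%N & (0 < m v)%N.
Proof.
rewrite /cmwt lt0n; apply: contraNP => H.
rewrite big1 // => v _; apply/eqP; rewrite muln_eq0; apply/contraT.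
by rewrite negb_or -!lt0n => /andP [wv mv]; case: H; exists v.
Qed.

Lemma cmwt_ge w m v : (w v * m v <= cmwt w m)%N.
Proof.
rewrite /cmwt; case: (boolP (v \in finsupp (cmonom_val m))) => [vm|].
  by rewrite (big_fsetD1 _ vm) /= leq_addr.
by rewrite memNfinsupp => /eqP ->; rewrite muln0.
Qed.

Lemma cmonom_div m v : (0 < m v)%N -> m = mmul (ucm v) (divcm m (ucm v)).
Proof.
move=> mv; apply/eqP/cmP => u; rewrite cmM divcmE cmU.
by case: eqVneq => [<-|_]; rewrite ?subn0 // subnKC.
Qed.

Lemma cmonom_ind (P : {cmonom I} -> Prop) : P mone ->
  (forall v m, P m -> P (mmul (ucm v) m)) -> forall m, P m.
Proof.
move=> P1 PU m; have [n] := ubnP (mdeg m).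
elim: n m => // n IH m; rewrite ltnS => le.
have [/eqP|m0] := eqVneq (mdeg m) 0%N; first by rewrite mdeg_eq0 => /eqP ->.
have [v mv] : exists v, (0 < m v)%N.
  apply: contrapT => H; case/eqP: m0; rewrite mdegE big1 // => v _.
  by apply/eqP/contraT; rewrite -lt0n => mv; case: H; exists v.
rewrite (cmonom_div mv); apply/PU/IH; apply: leq_trans le.
by rewrite [X in (_ < mdeg X)%N](cmonom_div mv) mdegM mdegU.
Qed.

Lemma cmonom_mulUK m v : divcm (mmul (ucm v) m) (ucm v) = m.
Proof. by apply/eqP/cmP => u; rewrite divcmE cmM cmU addKn. Qed.

End MonomialWeight.

Section MalgSupport.
Variables (F : fieldType) (K : choiceType).
Implicit Types (p q : {malg F[K]}) (P Q : K -> Prop).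

(** Homogeneity, color bounds and membership in the span of a list of basis vectors are all of this
    form. *)
Definition supported P p := forall k, k \in msupp p -> P k.

Lemma supported0 P : supported P 0.
Proof. by move=> k; rewrite msupp0. Qed.

Lemma supportedU P k : P k -> supported P << k >>.
Proof. by move=> Pk k'; rewrite msuppU oner_eq0 in_fset1 => /eqP ->. Qed.

Lemma supportedD P p q : supported P p -> supported P q -> supported P (p + q).
Proof.
move=> Pp Pq k /(fsubsetP (msuppD_le _ _)); rewrite in_fsetU.
by case/orP => [/Pp|/Pq].
Qed.

Lemma supportedZ P c p : supported P p -> supported P (c *: p).
Proof. by move=> Pp k /(fsubsetP (msuppZ_le _ _))/Pp. Qed.

Lemma supported_sum P (T : Type) (r : seq T) (B : pred T) (f : T -> {malg F[K]}) :
  (forall i, B i -> supported P (f i)) -> supported P (\sum_(i <- r | B i) f i).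
Proof.
move=> H; elim/big_rec: _ => [|i p Bi Pp]; first exact: supported0.
by apply: supportedD => //; apply: H.
Qed.

Lemma supported_imp P Q p : (forall k, P k -> Q k) -> supported P p -> supported Q p.
Proof. by move=> PQ Pp k /Pp/PQ. Qed.

Lemma supported_ind P (R : {malg F[K]} -> Prop) :
  R 0 -> (forall c u v, R u -> R v -> R (c *: u + v)) ->
  (forall k, P k -> R << k >>) -> forall p, supported P p -> R p.
Proof.
move=> R0 RD RU p Pp; rewrite [p]monalgE big_seq_cond.
elim/big_rec: _ => // k u; rewrite andbT => kp Ru.
by rewrite malgU_scale; apply: RD => //; apply/RU/Pp.
Qed.

Lemma supportedUc P c k : (c != 0 -> P k) -> supported P << c *g k >>.
Proof.
by move=> Pk k'; rewrite msuppU; case: ifPn => // /Pk Pk'; rewrite in_fset1 => /eqP ->.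
Qed.

End MalgSupport.

Lemma supported_mext (F : fieldType) (K L : choiceType) (P : K -> Prop)
    (Q : L -> Prop) (f : K -> {malg F[L]}) (p : {malg F[K]}) :
  (forall k, P k -> supported Q (f k)) -> supported P p -> supported Q (mext f p).
Proof.
move=> H; move: p; apply: supported_ind => [|c u v Hu Hv|k Pk].
- by rewrite raddf0; apply: supported0.
- by rewrite linearP; apply: supportedD => //; apply: supportedZ.
- by rewrite mextU; apply: H.
Qed.

Section MalgRing.
Variables (F : fieldType) (K : conomType).
Implicit Types (p q : {malg F[K]}) (P Q : K -> Prop).

Lemma malgUM (k k' : K) : << k >> * << k' >> = << mmul k k' >> :> {malg F[K]}.
Proof. by rewrite malgM_def fgmulUU mulr1. Qed.

Lemma supported1 P : P mone -> supported P (1 : {malg F[K]}).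
Proof. exact: supportedU. Qed.

Lemma supportedM P Q (R : K -> Prop) p q :
  (forall k k', P k -> Q k' -> R (mmul k k')) ->
  supported P p -> supported Q q -> supported R (p * q).
Proof. by move=> H Pp Qq k /msuppM_le [k1 [k2 [/Pp P1 /Qq Q2 ->]]]; apply: H. Qed.

Lemma malgUM_coef (c c' : F) (k k' : K) :
  << c *g k >> * << c' *g k' >> = << c * c' *g mmul k k' >> :> {malg F[K]}.
Proof. by rewrite malgM_def fgmulUU. Qed.

(** For a partial derivative, [e] is the exponent of the variable and [d] divides by it. The
    truncated division is multiplicative only if the variable occurs, hence the restriction to
    [e k != 0]; elsewhere the coefficient vanishes. *)
Lemma mext_derivation (e : K -> F) (d : K -> K) :
  (forall k k', e (mmul k k') = e k + e k') ->
  (forall k k', e k != 0 -> d (mmul k k') = mmul (d k) k') ->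
  forall p q, let f := mext (fun k => << e k *g d k >> : {malg F[K]}) in
  f (p * q) = f p * q + p * f q.
Proof.
move=> eM dM p q /=.
elim/malg_linind: p => [|c u v Hu Hv|k].
- by rewrite !(mul0r, raddf0, addr0).
- rewrite mulrDl -scalerAl !linearP /= Hu Hv !mulrDl -!scalerAl scalerDr.
  by rewrite addrACA.
elim/malg_linind: q => [|c u v Hu Hv|k'].
- by rewrite !(mulr0, raddf0, addr0).
- rewrite mulrDr -scalerAr !linearP /= Hu Hv !mulrDr -!scalerAr scalerDr.
  by rewrite addrACA.
rewrite malgUM !mextU !malgUM_coef mulr1 mul1r eM monalgUD; congr (_ + _).
  by have [->|/dM ->] := eqVneq (e k) 0; rewrite ?monalgU0.
have [->|e0] := eqVneq (e k') 0; first by rewrite !monalgU0.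
by rewrite [mmul k k']mulmC dM // mulmC.
Qed.

Lemma mext_coefU (e : K -> F) (d : K -> K) (c : F) (k : K) :
  mext (fun k => << e k *g d k >> : {malg F[K]}) << c *g k >> = << c * e k *g d k >>.
Proof.
by rewrite malgU_scale linearZ /= mextU [in LHS]malgU_scale scalerA -malgU_scale.
Qed.

Lemma mext_coefC (e e' : K -> F) (d d' : K -> K) :
  (forall k, e' k * e (d' k) = e k * e' (d k)) -> (forall k, d (d' k) = d' (d k)) ->
  let f := mext (fun k => << e k *g d k >> : {malg F[K]}) in
  let f' := mext (fun k => << e' k *g d' k >> : {malg F[K]}) in
  forall p, f (f' p) = f' (f p).
Proof.
move=> eC dC /= p; elim/malg_linind: p => [|c u v Hu Hv|k]; first by rewrite !raddf0.
  by rewrite !linearP /= Hu Hv.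
by rewrite !mext_coefU !mul1r eC dC.
Qed.

End MalgRing.

(** * Coefficients of vertex operators *)

Section VertexExponential.
Variables (F : numFieldType) (l : nat) (A : comAlgType F) (X : 'I_l -> nat -> A).
Implicit Types (p q : A) (a b : 'I_l -> F) (k n : nat).

(** With [X i k] standing for alpha_i(-k-1), as in [fock_monom], this is b(-k-1) for b = \sum_i a_i
    alpha_i; hence the predecessors in [vexp]. *)
Definition creation a k : A := \sum_i a i *: X i k.

Lemma creation_mul a k p : creation a k * p = \sum_i a i *: (X i k * p).
Proof. by rewrite mulr_suml; apply: eq_bigr => i _; rewrite scalerAl. Qed.

Lemma creationD a a' k : creation (fun i => a i + a' i) k = creation a k + creation a' k.
Proof.
by rewrite /creation -big_split /=; apply: eq_bigr => i _; rewrite scalerDl.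
Qed.

Lemma creation_delta j k : creation (fun i => (i == j)%:R) k = X j k.
Proof.
rewrite /creation (bigD1 j) //= eqxx scale1r big1 ?addr0 // => i /negPf ->.
by rewrite scale0r.
Qed.

(* vexp a n is the coefficient of x^n in E^-(-b, x) = exp(\sum_n b(-n) x^n / n),
   where b = \sum_i a_i alpha_i. *)
Definition vexp a n : A := erec (fun m p => creation a m.-1 * p) 1 n.

Lemma vexp0 a : vexp a 0 = 1. Proof. by []. Qed.

Lemma vexpS a n :
  n.+1%:R *: vexp a n.+1 = \sum_(m < n.+1) creation a m * vexp a (n - m).
Proof. exact: erecS. Qed.

Lemma vexp_unique (e : nat -> A) a : e 0%N = 1 ->
  (forall n, n.+1%:R *: e n.+1 = \sum_(m < n.+1) creation a m * e (n - m)%N) ->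
  e =1 vexp a.
Proof.
move=> e0 eS n; elim/ltn_ind: n => -[|n] IH; first by rewrite e0.
apply: (@scalerI _ _ n.+1%:R); first by rewrite pnatr_eq0.
by rewrite eS vexpS; apply: eq_bigr => m _; rewrite IH // ltnS leq_subr.
Qed.

Definition conv (e f : nat -> A) n : A := \sum_(i < n.+1) e i * f (n - i)%N.

Lemma convC e f n : conv e f n = conv f e n.
Proof.
rewrite /conv (reindex_inj rev_ord_inj) /=; apply: eq_bigr => i _.
by rewrite subSS mulrC subKn // -ltnS.
Qed.

(** The recursion of [vexp a] multiplied by an arbitrary series [f], so that it yields both halves
    of the product rule in [vexpD]. *)
Lemma conv_vexp_deriv a (f : nat -> A) n :
  \sum_(i < n.+2) (i%:R *: vexp a i) * f (n.+1 - i)%N =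
  \sum_(m < n.+1) creation a m * conv (vexp a) f (n - m)%N.
Proof.
rewrite big_ord_recl scale0r mul0r add0r.
transitivity (\sum_(i < n.+1) \sum_(m < (n - i).+1)
    creation a m * vexp a (n - i - m)%N * f i).
  rewrite (reindex_inj rev_ord_inj) /=; apply: eq_bigr => i _.
  rewrite /bump /= add1n subSS vexpS !subSS mulr_suml.
  have le : (i <= n)%N by rewrite -ltnS.
  by rewrite subKn //; apply: eq_bigr => m _; rewrite mulrA.
rewrite (big_triangle_exchange n
  (fun i m => creation a m * vexp a (n - i - m)%N * f i)).
apply: eq_bigr => m _; rewrite convC /conv mulr_sumr; apply: eq_bigr => i _.
by rewrite -mulrA [X in _ * X]mulrC subnAC.
Qed.

(** By the product rule the convolution satisfies the recursion attached to the sum of the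
    exponents, and that recursion has only one solution. *)
Lemma vexpD a a' n : vexp (fun i => a i + a' i) n = conv (vexp a) (vexp a') n.
Proof.
apply/esym/vexp_unique; first by rewrite /conv big_ord1 mulr1.
move=> {}n; rewrite /conv scaler_sumr.
transitivity (\sum_(i < n.+2) (i%:R *: vexp a i) * vexp a' (n.+1 - i)%N +
   \sum_(i < n.+2) vexp a i * ((n.+1 - i)%:R *: vexp a' (n.+1 - i)%N)).
  rewrite -big_split /=; apply: eq_bigr => i _.
  rewrite -scalerAl -scalerAr -scalerDl -natrD subnKC //.
  by rewrite -ltnS.
rewrite conv_vexp_deriv.
rewrite [X in _ + X](_ : _ = \sum_(m < n.+1) creation a' m * conv (vexp a) (vexp a') (n - m)%N).
  by rewrite -big_split /=; apply: eq_bigr => m _; rewrite creationD mulrDl.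
under [RHS]eq_bigr do rewrite convC.
rewrite -conv_vexp_deriv [RHS](reindex_inj rev_ord_inj) /=.
apply: eq_bigr => i _; rewrite subSS mulrC; congr (_ * vexp a _).
by rewrite subKn // -ltnS.
Qed.

Lemma vexp_eq a a' : a =1 a' -> vexp a =1 vexp a'.
Proof.
move=> aa'; apply: vexp_unique => // n; rewrite vexpS; apply: eq_bigr => m _.
by congr (_ * _); apply: eq_bigr => i _; rewrite aa'.
Qed.

Lemma vexp_zero n : vexp (fun _ => 0) n = (n == 0%N)%:R.
Proof.
apply/esym; move: n; apply: vexp_unique => // n; rewrite scaler0 big1 // => m _.
by rewrite /creation big1 ?mul0r // => i _; rewrite scale0r.
Qed.

Variable D : 'I_l -> nat -> A -> A.
Hypothesis D_linear : forall i k, linear (D i k).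
Hypothesis DM : forall i k p q, D i k (p * q) = D i k p * q + p * D i k q.
Hypothesis DX : forall i k j n, D i k (X j n) = ((i == j) && (k == n))%:R%:A.

(** With [D i k] the derivative by alpha_i(-k-1) and b_i = <b', alpha_i>, this is b'(k+1). Since the
    a_i of [creation] are coordinates and the b_i pairings, \sum_i a_i b_i is the value of the
    form. *)
Definition annihilation b k p : A := \sum_i (k.+1%:R * b i) *: D i k p.

Lemma annihilation_linear b k : linear (annihilation b k).
Proof.
move=> c p q; rewrite /annihilation scaler_sumr -big_split /=.
by apply: eq_bigr => i _; rewrite D_linear scalerDr !scalerA mulrC.
Qed.

HB.instance Definition _ b k :=
  GRing.isLinear.Build F A A _ (annihilation b k) (annihilation_linear b k).

Lemma annihilationZ b k c p : annihilation b k (c *: p) = c *: annihilation b k p.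
Proof. exact: linearZ. Qed.

Lemma annihilationC b b' k k' p :
  (forall i i' p, D i k (D i' k' p) = D i' k' (D i k p)) ->
  annihilation b k (annihilation b' k' p) = annihilation b' k' (annihilation b k p).
Proof.
move=> DC; rewrite /annihilation.
under eq_bigr => i _ do rewrite (linfun_sum (D_linear i k)) scaler_sumr.
rewrite exchange_big /=; apply: eq_bigr => i _.
rewrite (linfun_sum (D_linear i k')) scaler_sumr; apply: eq_bigr => j _ /=.
by rewrite !(linfunZ (D_linear _ _)) !scalerA DC mulrC.
Qed.

Lemma annihilationM b k p q :
  annihilation b k (p * q) = annihilation b k p * q + p * annihilation b k q.
Proof.
rewrite /annihilation mulr_suml mulr_sumr -big_split /=.
by apply: eq_bigr => i _; rewrite DM scalerDr -scalerAl -scalerAr.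
Qed.

Lemma annihilation_creation b a k n :
  annihilation b k (creation a n) = ((k == n)%:R * (k.+1%:R * \sum_i a i * b i))%:A.
Proof.
rewrite raddf_sum mulrCA !mulr_sumr scaler_suml.
apply: eq_bigr => j _; rewrite /= annihilationZ /annihilation (bigD1 j) //= big1 ?addr0.
  by rewrite DX eqxx /= !scalerA; congr (_ *: _); ring.
by move=> i ij; rewrite DX (negPf ij) !scale0r scaler0.
Qed.

(** A derivation multiplies exp(u) by the derivative of u, and only the term of u in x^(k+1) is not
    killed: its derivative is the scalar \sum_i a_i b_i, the factor k+1 cancelling the denominator.
    Hence the index drops by k+1. *)
Lemma annihilation_vexp b a k n : annihilation b k (vexp a n) =
  if (k < n)%N then (\sum_i a i * b i) *: vexp a (n - k.+1) else 0.
Proof.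
set s := \sum_i _.
elim/ltn_ind: n => -[|n] IH.
  have := annihilationM b k 1 1; rewrite mulr1 mul1r vexp0 => /eqP.
  by rewrite mulr1 -subr_eq0 opprD addNKr oppr_eq0 => /eqP.
apply: (@scalerI _ _ n.+1%:R); first by rewrite pnatr_eq0.
rewrite -annihilationZ vexpS raddf_sum.
under eq_bigr => m _.
  rewrite /= annihilationM annihilation_creation -/s IH ?ltnS ?leq_subr //.
  rewrite -scalerAl mul1r.
  over.
rewrite big_split /=.
have [kn|nk] := ltnP k n.+1; last first.
  rewrite !big1 ?addr0 ?scaler0 // => m _.
    by rewrite ifF ?mulr0 //; apply/negbTE; rewrite -leqNgt; lia.
  have -> : (k == m) = false by apply/negbTE; have := ltn_ord m; lia.
  by rewrite mul0r scale0r.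
rewrite (bigD1 (Ordinal kn)) //= eqxx mul1r [X in _ + X + _]big1 ?addr0; last first.
  by move=> m; rewrite -val_eqE /= eq_sym => /negPf ->; rewrite mul0r scale0r.
rewrite subSS; case: (posnP (n - k)) => [nk0|nk0].
  rewrite big1 ?addr0; last first.
    by move=> m _; rewrite ifF ?mulr0 //; apply/negbTE; rewrite -leqNgt; lia.
  have -> : k = n by lia.
  by rewrite scalerA.
(* The part k+1 comes from the derivation hitting [creation a k]; the part n-k is the recursion of
   [vexp a (n - k)], recovered from the terms in which it hits the remaining exponential. *)
have -> : n.+1%:R = k.+1%:R + (n - k)%:R :> F by rewrite -natrD; congr (_ %:R); lia.
rewrite [RHS]scalerDl -scalerA; congr (_ + _).
rewrite scalerA mulrC -scalerA.
case E : (n - k)%N nk0 => [//|n'] _; rewrite vexpS scaler_sumr.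
have le : (n'.+1 <= n.+1)%N by lia.
rewrite (big_ord_widen _ (fun m => s *: (creation a m * vexp a (n' - m))) le).
rewrite [RHS]big_mkcond /=; apply: eq_bigr => m _.
have -> : (k < n - m)%N = (m < n'.+1)%N by lia.
case: ifP => [mn|]; last by rewrite mulr0.
by rewrite -scalerAr; congr (_ *: (_ * vexp a _)); lia.
Qed.

End VertexExponential.

(** * The filtration by degree in the complete symmetric functions *)

Lemma eq0_or_gt0 (I : finType) (c : I -> nat) :
  (forall i, c i = 0%N) \/ exists i, (0 < c i)%N.
Proof.
have [/existsP [i ci]|] := boolP [exists i, 0 < c i]%N; first by right; exists i.
by rewrite negb_exists => /forallP c0; left => i; have := c0 i; case: (c i).
Qed.

Section ColorFiltration.
Variables (F : numFieldType) (l : nat) (A : comAlgType F) (X : 'I_l -> nat -> A).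
Notation mon := {cmonom ('I_l * nat)%type}.
Implicit Types (p q : A) (m : mon) (v : ('I_l * nat)%type) (c d : 'I_l -> nat).

Definition cdeg (j : 'I_l) m : nat := cmwt (fun v => (v.1 == j) : nat) m.

Lemma cdeg1 j : cdeg j mone = 0%N. Proof. exact: cmwt1. Qed.

Lemma cdegM j m m' : cdeg j (mmul m m') = (cdeg j m + cdeg j m')%N.
Proof. exact: cmwtM. Qed.

Lemma cdegU j v : cdeg j (ucm v) = (v.1 == j).
Proof. exact: cmwtU. Qed.

(* Under the identification of alpha_j(-n) with power sums, hpoly j r is the
   complete homogeneous symmetric function of degree r. *)
Definition hpoly j r : A := vexp X (fun i => (i == j)%:R) r.

Lemma hpolyS j n : hpoly j n.+1 =
  n.+1%:R^-1 *: X j n + n.+1%:R^-1 *: \sum_(m < n) X j m * hpoly j (n - m).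
Proof.
have -> : hpoly j n.+1 = n.+1%:R^-1 *: (n.+1%:R *: hpoly j n.+1).
  by rewrite scalerA mulVf ?pnatr_eq0 // scale1r.
rewrite /hpoly vexpS big_ord_recr /= subnn vexp0 mulr1 creation_delta.
rewrite addrC scalerDr; congr (_ + _ *: _).
by apply: eq_bigr => m _; rewrite creation_delta.
Qed.

(** The variable (j, k) goes to h_(j,k+1): the shift keeps the constant h_(j,0) out of the
    generators. *)
Definition hmon m : A :=
  \prod_(v <- finsupp (cmonom_val m)) hpoly v.1 v.2.+1 ^+ m v.

Lemma hmon1 : hmon mone = 1.
Proof. by rewrite /hmon mdom1 big_seq_fset0. Qed.

Lemma hmonU v : hmon (ucm v) = hpoly v.1 v.2.+1.
Proof. by rewrite /hmon mdomU big_seq_fset1 cmUU expr1. Qed.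

Lemma hmon_widen m (d : {fset 'I_l * nat}) : (finsupp (cmonom_val m) `<=` d)%fset ->
  hmon m = \prod_(v <- d) hpoly v.1 v.2.+1 ^+ m v.
Proof.
move=> le; rewrite /hmon (big_fset_incl _ le) // => v _.
by rewrite memNfinsupp => /eqP ->; rewrite expr0.
Qed.

Lemma hmonM m m' : hmon (mmul m m') = hmon m * hmon m'.
Proof.
pose d := (finsupp (cmonom_val m) `|` finsupp (cmonom_val m'))%fset.
rewrite !(@hmon_widen _ d) ?mdomD ?fsubset_refl ?fsubsetUl ?fsubsetUr //.
by rewrite -big_split /=; apply: eq_bigr => v _; rewrite cmM exprD.
Qed.

Definition cdeg_le c m : Prop := forall j, (cdeg j m <= c j)%N.

Lemma cdeg_le0 c m : (forall j, c j = 0%N) -> cdeg_le c m -> m = mone.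
Proof.
move=> c0 cm; apply/eqP/cmP => v; rewrite cm1; have := cm v.1; rewrite c0 leqn0 => /eqP H.
have := cmwt_ge (fun u => (u.1 == v.1) : nat) m v.
by rewrite -/(cdeg v.1 m) H eqxx mul1n leqn0 => /eqP.
Qed.

(** The space T_c of the overview, as an image; independence of the h-monomials enters only with the
    dimension count. *)
Definition colorfilt c p : Prop :=
  exists2 q : {malg F[mon]}, p = mext hmon q & supported (cdeg_le c) q.

Lemma colorfilt_hmon c m : cdeg_le c m -> colorfilt c (hmon m).
Proof. by move=> cm; exists << m >>; [rewrite mextU | apply: supportedU]. Qed.

Lemma colorfilt_ind c (R : A -> Prop) :
  R 0 -> (forall a p q, R p -> R q -> R (a *: p + q)) ->
  (forall m, cdeg_le c m -> R (hmon m)) -> forall p, colorfilt c p -> R p.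
Proof.
move=> R0 RD RU _ [q -> cq].
move: q cq; apply: supported_ind => [|a u v Ru Rv|m cm].
- by rewrite raddf0.
- by rewrite linearP; apply: RD.
- by rewrite mextU; apply: RU.
Qed.

Lemma colorfilt0 c : colorfilt c 0.
Proof. by exists 0; [rewrite raddf0 | apply: supported0]. Qed.

Lemma colorfiltP c a p q : colorfilt c p -> colorfilt c q -> colorfilt c (a *: p + q).
Proof.
move=> [p' -> cp] [q' -> cq]; exists (a *: p' + q'); first by rewrite linearP.
by apply: supportedD => //; apply: supportedZ.
Qed.

Lemma colorfiltZ c a p : colorfilt c p -> colorfilt c (a *: p).
Proof. by move=> cp; rewrite -[a *: p]addr0; apply/colorfiltP/colorfilt0. Qed.

Lemma colorfiltD c p q : colorfilt c p -> colorfilt c q -> colorfilt c (p + q).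
Proof. by move=> cp cq; rewrite -[p]scale1r; apply: colorfiltP. Qed.

Lemma colorfilt_sum c (T : Type) (r : seq T) (B : pred T) (f : T -> A) :
  (forall i, B i -> colorfilt c (f i)) -> colorfilt c (\sum_(i <- r | B i) f i).
Proof.
move=> H; elim/big_rec: _ => [|i p Bi Pp]; first exact: colorfilt0.
by apply: colorfiltD => //; apply: H.
Qed.

Lemma colorfilt_le c d p : (forall j, (c j <= d j)%N) -> colorfilt c p -> colorfilt d p.
Proof.
move=> cd [q -> cq]; exists q => //; apply: supported_imp cq => m cm j.
exact: leq_trans (cm j) (cd j).
Qed.

Lemma colorfilt1 c : colorfilt c 1.
Proof. by rewrite -hmon1; apply: colorfilt_hmon => j; rewrite cdeg1. Qed.

Lemma colorfiltM c d p q : colorfilt c p -> colorfilt d q ->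
  colorfilt (fun j => c j + d j)%N (p * q).
Proof.
move: p; apply: colorfilt_ind => [_|a p p' Hp Hp' dq|m cm].
- by rewrite mul0r; apply: colorfilt0.
- by rewrite mulrDl -scalerAl; apply: colorfiltP; [apply: Hp | apply: Hp'].
move: q; apply: colorfilt_ind => [|a p p' Hp Hp'|m' cm'].
- by rewrite mulr0; apply: colorfilt0.
- by rewrite mulrDr -scalerAr; apply: colorfiltP.
by rewrite -hmonM; apply: colorfilt_hmon => j; rewrite cdegM leq_add.
Qed.

Lemma colorfilt_hpoly j r : colorfilt (fun i => (i == j) : nat) (hpoly j r).
Proof.
case: r => [|r]; first exact: colorfilt1.
by rewrite -(hmonU (j, r)); apply: colorfilt_hmon => i; rewrite cdegU eq_sym.
Qed.

Lemma colorfilt_vexp c r : colorfilt c (vexp X (fun i => (c i)%:R) r).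
Proof.
have [n] := ubnP (\sum_i c i)%N; elim: n c r => // n IH c r le.
have [c0|[j cj]] := eq0_or_gt0 c.
  rewrite (@vexp_eq _ _ _ _ _ (fun _ => 0)) => [|i]; last by rewrite c0.
  rewrite vexp_zero; case: eqP => _; first exact: colorfilt1.
  exact: colorfilt0.
pose d i := (c i - (i == j))%N.
have cE i : c i = (d i + (i == j))%N by rewrite /d; case: eqP => [->|_]; lia.
rewrite (@vexp_eq _ _ _ _ _ (fun i => (d i)%:R + (i == j)%:R)); last first.
  by move=> i; rewrite -natrD -cE.
rewrite vexpD; apply: colorfilt_sum => i _.
apply: (@colorfilt_le (fun i => d i + (i == j))%N) => [k|]; first by rewrite -cE.
apply/colorfiltM/colorfilt_hpoly/IH; move: le.
rewrite (bigD1 j) //= [X in _ -> (X < _)%N](bigD1 j) //=.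
rewrite (eq_bigr d); first by rewrite /d eqxx; lia.
by move=> k kj; rewrite /d (negPf kj) subn0.
Qed.

(** If m has fewer than c_j factors of color j, the factor split off is h_(j,0) = 1. Thus T_c is
    reached from a smaller T_c' by one multiplication even where the bound is not attained. *)
Lemma hmon_split c m j : cdeg_le c m -> (0 < c j)%N ->
  exists r m', hmon m = hpoly j r * hmon m' /\
    cdeg_le (fun i => c i - (i == j))%N m'.
Proof.
move=> cm cj; have [le|ge] := ltnP (cdeg j m) (c j).
  exists 0%N, m; rewrite mul1r; split=> // i.
  by case: eqVneq => [->|_]; rewrite ?subn0 //; lia.
have [v vj mv] : exists2 v, (0 < ((v.1 == j) : nat))%N & (0 < m v)%N.
  by apply: cmwt_gt0P; apply: leq_trans cj ge.
have {}vj : v.1 = j by apply/eqP; case: eqP vj.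
exists v.2.+1, (divcm m (ucm v)); split.
  by rewrite -vj -hmonU -hmonM -cmonom_div.
move=> i; have := cm i; rewrite {1}(cmonom_div mv) cdegM cdegU vj [j == i]eq_sym.
case: (i == j); rewrite ?subn0 // subn1 add1n => h.
by rewrite -ltnS (ltn_predK h).
Qed.

Variable D : 'I_l -> nat -> A -> A.
Hypothesis D_linear : forall i k, linear (D i k).
Hypothesis DM : forall i k p q, D i k (p * q) = D i k p * q + p * D i k q.
Hypothesis DX : forall i k j n, D i k (X j n) = ((i == j) && (k == n))%:R%:A.

Lemma colorfilt_annihilation b k c p :
  colorfilt c p -> colorfilt c (annihilation D b k p).
Proof.
move: p; apply: colorfilt_ind => [|a p q Hp Hq|m cm].
- have := annihilation_linear D_linear b k (-1) 0 0.
  by rewrite scaler0 addr0 scaleN1r addNr => ->; apply: colorfilt0.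
- by rewrite annihilation_linear //; apply: colorfiltP.
(* The bound is tightened to the exact color degrees of m, which are additive, so that m can be
   built up one variable at a time. *)
apply: (@colorfilt_le (cdeg ^~ m)) => //; move: m {cm}; apply: cmonom_ind => [|v m IH].
  rewrite hmon1; have := annihilation_vexp D_linear DM DX b (fun=> 0) k 0.
  by rewrite vexp0 => ->; apply: colorfilt0.
apply: (@colorfilt_le (fun j => (j == v.1) + cdeg j m)%N) => [j|].
  by rewrite cdegM cdegU eq_sym.
rewrite hmonM hmonU annihilationM //; apply: colorfiltD; last first.
  exact/colorfiltM/IH/colorfilt_hpoly.
apply: colorfiltM; last exact: colorfilt_hmon.
rewrite annihilation_vexp //; case: ifP => _; last exact: colorfilt0.
exact/colorfiltZ/colorfilt_hpoly.
Qed.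

(* vderiv b p n is the coefficient of x^-n in E^+(-b', x) p, where b has
   coordinates b_i = <b', alpha_i>. *)
Definition vderiv b p n : A := erec (fun k p => - annihilation D b k.-1 p) p n.

Lemma colorfilt_vderiv b c p n : colorfilt c p -> colorfilt c (vderiv b p n).
Proof.
move=> cp; elim/ltn_ind: n => -[|n] IH //.
have -> : vderiv b p n.+1 = n.+1%:R^-1 *: (n.+1%:R *: vderiv b p n.+1).
  by rewrite scalerA mulVf ?pnatr_eq0 // scale1r.
apply: colorfiltZ; rewrite /vderiv erecS; apply: colorfilt_sum => m _.
rewrite -scaleN1r; apply/colorfiltZ/colorfilt_annihilation/IH.
by rewrite ltnS leq_subr.
Qed.

End ColorFiltration.

(** * The Fock space *)

Lemma alg_mul_leading (F : comPzRingType) (A : comAlgType F) (c d : F) (x y p q : A) :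
  (c *: x + q) * (d *: y + p) = (c * d) *: (x * y) + ((c *: x) * p + q * (d *: y + p)).
Proof.
by rewrite mulrDl addrA [(c *: x) * (_ + _)]mulrDr -scalerAr -scalerAl scalerA [d * c]mulrC.
Qed.

Section FockSpace.
Variables (F : numFieldType) (l : nat).
Notation var := ('I_l * nat)%type.
Notation mon := {cmonom var}.

Definition Fock : comAlgType F := {malg F[mon]}.

Implicit Types (p q : Fock) (m : mon) (v : var) (a b : 'I_l -> F) (k n : nat).

Definition fvar (i : 'I_l) k : Fock := << ucm (i, k) : mon >>.

Definition pderiv v : Fock -> Fock :=
  mext (fun m => << (m v)%:R *g divcm m (ucm v) : mon >> : Fock).

Lemma pderivU v c m :
  pderiv v << c *g m >> = << c * (m v)%:R *g divcm m (ucm v) : mon >>.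
Proof. exact: mext_coefU. Qed.

Lemma pderiv_linear v : linear (pderiv v).
Proof. exact: mext_is_linear. Qed.

Lemma pderivM v p q : pderiv v (p * q) = pderiv v p * q + p * pderiv v q.
Proof.
apply: mext_derivation => m m'; first by rewrite cmM natrD.
rewrite pnatr_eq0 -lt0n => m0.
by rewrite [in LHS](cmonom_div m0) -[mmul (mmul _ _) m']mulcmA cmonom_mulUK.
Qed.

Lemma pderivX i k j n :
  pderiv (i, k) (fvar j n) = ((i == j) && (k == n))%:R%:A.
Proof.
rewrite pderivU mul1r cmU xpair_eqE eq_sym [n == k]eq_sym.
case: andP => [[/eqP -> /eqP ->]|_]; last by rewrite scale0r monalgU0.
by rewrite scale1r -[X in divcm X _]mulcm0 cmonom_mulUK.
Qed.

Lemma pderivC u v p : pderiv u (pderiv v p) = pderiv v (pderiv u p).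
Proof.
apply: mext_coefC => m; last by apply/eqP/cmP => i; rewrite !divcmE subnAC.
rewrite !divcmE !cmU [u == v]eq_sym -!natrM; congr (_ %:R).
by case: eqVneq => [->//|_]; rewrite !subn0 mulnC.
Qed.

Definition fderiv (i : 'I_l) k := pderiv (i, k).

Definition mwt m : nat := cmwt (fun v => v.2.+1) m.

Lemma mwt1 : mwt mone = 0%N. Proof. exact: cmwt1. Qed.

Lemma mwtM m m' : mwt (mmul m m') = (mwt m + mwt m')%N. Proof. exact: cmwtM. Qed.

Lemma mwtU v : mwt (ucm v) = v.2.+1. Proof. exact: cmwtU. Qed.

Definition homog n p : Prop := supported (fun m => mwt m = n) p.

Lemma homog1 : homog 0 1. Proof. by apply: supported1; rewrite mwt1. Qed.

Lemma homogM n n' p q : homog n p -> homog n' q -> homog (n + n') (p * q).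
Proof. by apply: supportedM => k k' <- <-; rewrite mwtM. Qed.

Lemma homogZ n c p : homog n p -> homog n (c *: p).
Proof. exact: supportedZ. Qed.

Lemma homog_sum n (T : Type) (r : seq T) (B : pred T) (f : T -> Fock) :
  (forall i, B i -> homog n (f i)) -> homog n (\sum_(i <- r | B i) f i).
Proof. exact: supported_sum. Qed.

Lemma homog_creation a k : homog k.+1 (creation fvar a k).
Proof.
by apply: homog_sum => i _; apply: homogZ; apply: supportedU; apply: (mwtU (i, k)).
Qed.

Lemma unscale n p : p = n.+1%:R^-1 *: (n.+1%:R *: p).
Proof. by rewrite scalerA mulVf ?pnatr_eq0 // scale1r. Qed.

Lemma homog_vexp a n : homog n (vexp fvar a n).
Proof.
elim/ltn_ind: n => -[|n] IH; first exact: homog1.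
rewrite (unscale n (vexp fvar a n.+1)).
apply: homogZ; rewrite vexpS; apply: homog_sum => m _.
have E : (m.+1 + (n - m))%N = n.+1 by rewrite addSn subnKC // -ltnS.
rewrite -[X in homog X _]E.
by apply: homogM; [apply: homog_creation | apply: IH; rewrite ltnS leq_subr].
Qed.

Lemma homog_hmon m : homog (mwt m) (hmon fvar m).
Proof.
elim/cmonom_ind: m => [|v m IH]; first by rewrite hmon1 mwt1; apply: homog1.
by rewrite hmonM hmonU mwtM mwtU; apply: homogM IH; apply: homog_vexp.
Qed.

(* Homogeneous of degree n - s, with no truncation when n < s. *)
Definition homog_shift n s p : Prop := supported (fun m => mwt m + s = n)%N p.

Lemma homog_annihilation b k n s p : homog_shift n s p ->
  homog_shift n (s + k.+1) (annihilation fderiv b k p).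
Proof.
move=> hp; apply: supported_sum => i _; apply: supportedZ.
apply: supported_mext hp => m mn; apply: supportedUc => m0.
rewrite -mn {2}(cmonom_div (_ : 0 < m (i, k)))%N; last by rewrite lt0n -(pnatr_eq0 F).
by rewrite mwtM mwtU addnA addnC -!addnA [(_ + s)%N]addnC.
Qed.

Lemma homog_vderiv b n p s : homog n p -> homog_shift n s (vderiv fderiv b p s).
Proof.
move=> hp; elim/ltn_ind: s => -[|s] IH.
  by apply: supported_imp hp => m; rewrite addn0.
rewrite (unscale s (vderiv fderiv b p s.+1)) /vderiv erecS.
apply: supportedZ; apply: supported_sum => m _; rewrite -scaleN1r; apply: supportedZ.
have E : ((s - m) + m.+1)%N = s.+1 by rewrite addnS subnK // -ltnS.
have ms : (s - m < s.+1)%N by rewrite ltnS leq_subr.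
by have := homog_annihilation (b := b) (k := m) (IH _ ms); rewrite E.
Qed.

Lemma homog_vderiv_le b n p s : (s <= n)%N -> homog n p ->
  homog (n - s) (vderiv fderiv b p s).
Proof.
move=> sn hp; apply: supported_imp (homog_vderiv hp) => m <-.
by rewrite addnK.
Qed.

(** Bounds the powers of x^-1 in E^+ on a given vector, which makes each mode of a vertex operator a
    finite sum. *)
Lemma homog_vderiv_gt b n p s : (n < s)%N -> homog n p -> vderiv fderiv b p s = 0.
Proof.
move=> ns hp; have {}hp := homog_vderiv (b := b) (s := s) hp; apply/eqP; rewrite -msupp_eq0.
by apply/eqP/fsetP => m; rewrite in_fset0; apply/negP => /hp; lia.
Qed.

Lemma hpoly_leading j r :
  exists2 p, hpoly fvar j r.+1 = r.+1%:R^-1 *: fvar j r + p &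
    supported (fun m => 2 <= mdeg m)%N p.
Proof.
elim/ltn_ind: r => r IH.
rewrite hpolyS; eexists; first reflexivity.
apply: supportedZ; apply: supported_sum => m _.
have mr := ltn_ord m.
have [p pE p2] := IH (r - m).-1 ltac:(lia).
rewrite -(prednK (_ : 0 < r - m)%N) ?subn_gt0 // pE.
apply: (@supportedM _ {cmonom var} (fun m : mon => mdeg m = 1)%N (fun m : mon => 1 <= mdeg m)%N).
- by move=> k k' k1 k1'; rewrite mdegM k1.
- by apply: supportedU; rewrite mdegU.
apply: supportedD; last by apply: supported_imp p2 => k; apply: leq_trans.
by apply: supportedZ; apply: supportedU; rewrite mdegU.
Qed.

(** The linear part of h_(j,r+1) is alpha_j(-r-1) / (r+1), and there is no constant term. So the
    lowest part of a product of such factors is the product of the linear parts. *)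
Lemma hmon_leading m : exists c p, [/\ c != 0, hmon fvar m = c *: << m >> + p &
  supported (fun m' => mdeg m < mdeg m')%N p].
Proof.
elim/cmonom_ind: m => [|v m [c [p [c0 pE pm]]]].
  exists 1, 0; split; rewrite ?oner_eq0 //; first by rewrite hmon1 addr0 scale1r.
  exact: supported0.
have [q qE q2] := hpoly_leading v.1 v.2.
exists (v.2.+1%:R^-1 * c), ((v.2.+1%:R^-1 *: fvar v.1 v.2) * p + q * hmon fvar m).
split; first by rewrite mulf_neq0 // invr_eq0 pnatr_eq0.
  rewrite hmonM hmonU qE pE.
  etransitivity; first exact: (@alg_mul_leading F Fock).
  have <- : (fvar v.1 v.2 : {malg F[mon]}) * << m >> = << mmul (ucm v) m >>.
    by rewrite (surjective_pairing v); exact: malgUM.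
  reflexivity.
have hm : supported (fun m' => mdeg m <= mdeg m')%N (hmon fvar m).
  rewrite pE; apply: supportedD; first by apply: supportedZ; apply: supportedU.
  by apply: supported_imp pm => k; apply: ltnW.
rewrite mdegM mdegU; apply: supportedD.
  refine (supportedM (K := {cmonom var}) (P := fun k : mon => mdeg k = 1%N) _ _ pm) => [k k' kE|].
    by rewrite mdegM kE ltnS.
  by apply: supportedZ; apply: supportedU; apply: (mdegU (v.1, v.2)).
by apply: supportedM q2 hm => k k' k2 k'm; rewrite mdegM; exact: (leq_add k2 k'm).
Qed.

(** Take m of least polynomial degree in the support of q. No other monomial of the support
    contributes to the coefficient of m: its leading monomial is not m, and its other terms have
    larger degree. *)
Lemma hmon_inj (q : {malg F[mon]}) : mext (hmon fvar) q = 0 -> q = 0.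
Proof.
apply: contra_eq => q0.
have [m0 m0q] : exists m, m \in msupp q.
  apply: contrapT => H; case/negP: q0; rewrite -msupp_eq0.
  by apply/eqP/fsetP => m; rewrite in_fset0; apply/negP => mq; apply: H; exists m.
have [m mq mmin] : exists2 m, m \in msupp q & forall m', m' \in msupp q -> (mdeg m <= mdeg m')%N.
  have ex : exists n, `[< exists2 m, m \in msupp q & mdeg m = n >].
    by exists (mdeg m0); apply/asboolP; exists m0.
  have [n /asboolP [m mq mn] nmin] := ex_minnP ex; exists m => // m' m'q.
  by rewrite mn; apply: nmin; apply/asboolP; exists m'.
have [c [p [c0 pE pm]]] := hmon_leading m.
have other m' : m' \in msupp q -> m' != m -> (hmon fvar m')@_m = 0.
  move=> m'q m'm; have [c' [p' [_ -> pm']]] := hmon_leading m'.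
  rewrite mcoeffD mcoeffZ mcoeffU (negPf m'm) mulr0 add0r mcoeff_outdom //.
  by apply/negP => /pm'; rewrite ltnNge mmin.
apply/eqP => /(congr1 (mcoeff m)); rewrite mcoeff0 => /eqP; apply/negP.
rewrite /mext (big_fsetD1 _ mq) /= mcoeffD [X in _ + X]raddf_sum
  [X in _ + X]big_seq_cond [X in _ + X]big1.
  rewrite addr0 mcoeffZ pE mcoeffD mcoeffZ mcoeffUU mulr1 [p@_m]mcoeff_outdom.
    by rewrite addr0 mulf_neq0 // mcoeff_neq0.
  by apply/negP => /pm; rewrite ltnn.
move=> m'; rewrite andbT in_fsetD1 => /andP [m'm m'q].
by rewrite /= mcoeffZ other ?mulr0.
Qed.

End FockSpace.

(** * Vertex operators on V_P *)

(** The pairs (i, j) with i - j = z are parametrized by j. Those with z + j negative do not exist,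
    and j > k contributes nothing. Characteristic zero turns the condition on scalars into one on
    integers. *)
Lemma fsbig_antidiagonal (F : numFieldType) (V : nmodType) (G : nat * nat -> V)
    (z t : int) (r : F) (k : nat) :
  (forall ij, (k < ij.2)%N -> G ij = 0) -> r = (z + t)%:~R ->
  \sum_(ij \in [set ij : nat * nat | ij.1%:R - ij.2%:R + t%:~R = r]) G ij =
  \sum_(j < k.+1) if (z + Posz j) is Posz i then G (i, j : nat) else 0.
Proof.
move=> G0 ->; set A := [set _ | _].
have AE ij : A ij <-> Posz ij.1 = z + Posz ij.2.
  rewrite /A /= !pmulrn -rmorphB -rmorphD; split=> [/intr_inj /addIr <-|->].
    by rewrite subrK.
  by rewrite addrK.
pose r0 := [seq (absz (z + Posz j), j) | j <- index_iota 0 k.+1 & (0 <= z + Posz j)%R].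
have rA ij : ij \in r0 -> A ij.
  case/mapP => j; rewrite mem_filter => /andP [zj _] ->.
  by apply/AE; rewrite /= gez0_abs.
rewrite (@fsbigE _ _ _ _ _ r0).
- rewrite big_seq_cond (eq_bigl (fun ij => ij \in r0)); last first.
    move=> ij /=; case: (boolP (ij \in r0)) => //= /rA Aij; exact/mem_set.
  rewrite -big_seq big_map big_filter big_mkcond big_mkord; apply: eq_bigr => j _.
  by case: (z + Posz j).
- rewrite map_inj_uniq ?filter_uniq ?iota_uniq // => j j' [] //.
- by move=> ij /= /rA.
move=> [i j] /AE /= ij; apply: contraNeq => Gij.
have jk : (j <= k)%N.
  by rewrite leqNgt; apply/negP => kj; rewrite G0 ?eqxx in Gij.
apply/mapP; exists j; last by rewrite -ij.
by rewrite mem_filter mem_index_iota -ij ltnS jk.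
Qed.

Lemma alg_mul_linear (F : comPzRingType) (A : comAlgType F) (x : A) : linear ( *%R x).
Proof. by move=> c p q; rewrite mulrDr scalerAr. Qed.

Lemma opp_linear (F : pzRingType) (W : lmodType F) (f : W -> W) :
  linear f -> linear (fun p => - f p).
Proof. by move=> lf c p q; rewrite lf opprD scalerN. Qed.

Lemma opp_commute (F : pzRingType) (W : lmodType F) (f g : W -> W) :
  linear f -> linear g -> (forall p, f (g p) = g (f p)) ->
  forall p, - f (- g p) = - g (- f p).
Proof.
move=> lf lg fg p.
by rewrite -[- g p]scaleN1r -[- f p]scaleN1r (linfunZ lf) (linfunZ lg) fg.
Qed.

Lemma linear_comp (F : pzRingType) (U V W : lmodType F) (f : V -> W) (h : U -> V) :
  linear f -> linear h -> linear (fun p => f (h p)).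
Proof. by move=> lf lh c p q; rewrite lh lf. Qed.

Lemma linear_scale (F : comPzRingType) (U V : lmodType F) (f : U -> V) a :
  linear f -> linear (fun p => a *: f p).
Proof. by move=> lf c p q; rewrite lf scalerDr !scalerA mulrC. Qed.

Lemma linear_sum (F : pzRingType) (U V : lmodType F) (I : Type) (r : seq I)
    (f : I -> U -> V) :
  (forall i, linear (f i)) -> linear (fun p => \sum_(i <- r) f i p).
Proof.
move=> lf c p q; rewrite scaler_sumr -big_split /=.
by apply: eq_bigr => i _; rewrite lf.
Qed.

Lemma supported_linear_eq (F : fieldType) (K : choiceType) (V : lmodType F)
    (P : K -> Prop) (f h : {malg F[K]} -> V) :
  linear f -> linear h -> (forall k, P k -> f << k >> = h << k >>) ->
  forall p, supported P p -> f p = h p.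
Proof.
move=> lf lh fh; apply: supported_ind => [|c u v Hu Hv|//].
  by rewrite !linfun0.
by rewrite lf lh Hu Hv.
Qed.

Section ErecTheory.
Variables (F : numFieldType) (V : lmodType F).

Lemma erec_linear (A : nat -> V -> V) n :
  (forall m, linear (A m)) -> linear (fun v => erec A v n).
Proof.
move=> lA c u v; elim/ltn_ind: n => -[|n] IH //.
apply: (@scalerI _ _ n.+1%:R); first by rewrite pnatr_eq0.
rewrite /= [RHS]scalerDr [_ *: (c *: _)]scalerA mulrC -scalerA !erecS scaler_sumr -big_split /=.
by apply: eq_bigr => m _; rewrite IH ?lA // ltnS leq_subr.
Qed.

End ErecTheory.

Lemma erec_mul (F : numFieldType) (l : nat) (A : comAlgType F) (X : 'I_l -> nat -> A)
    (a : 'I_l -> F) (p : A) n :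
  erec (fun m q => creation X a m.-1 * q) p n = vexp X a n * p.
Proof.
elim/ltn_ind: n => -[|n] IH; first by rewrite vexp0 mul1r.
apply: (@scalerI _ _ n.+1%:R); first by rewrite pnatr_eq0.
rewrite erecS scalerAl vexpS mulr_suml; apply: eq_bigr => m _.
by rewrite IH ?mulrA // ltnS leq_subr.
Qed.

Lemma vderiv_linear (F : numFieldType) (l : nat) (A : comAlgType F)
    (D : 'I_l -> nat -> A -> A) (b : 'I_l -> F) n :
  (forall i k, linear (D i k)) -> linear (fun p => vderiv D b p n).
Proof.
move=> lD; apply: erec_linear => m c u v.
by rewrite annihilation_linear // opprD scalerN.
Qed.

(** The maps [f e] are the embeddings of the Fock space as M(1) (x) e^d. The recursion for [opexp]
    requires commutation on all of V_P; it is deduced from the commutation of the [A'] because the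
    images of the [f e] span V_P. *)
Lemma opexp_intertwine (F : numClosedFieldType) (l : nat) (I : Type) (W : lmodType F)
    (f : I -> W -> VP F l) (A : opseries F l) (A' : nat -> W -> W) e q n :
  (forall e, linear (f e)) ->
  (forall P : VP F l -> Prop, P 0 -> (forall c u v, P u -> P v -> P (c *: u + v)) ->
    (forall e q, P (f e q)) -> forall v, P v) ->
  (forall i, linear (A i)) -> (forall v, A 0%N v = 0) ->
  (forall i e q, A i.+1 (f e q) = f e (i.+1%:R^-1 *: A' i.+1 q)) ->
  (forall i k q, A' i.+1 (A' k.+1 q) = A' k.+1 (A' i.+1 q)) ->
  (forall i, linear (A' i)) ->
  opexp A n (f e q) = f e (erec A' q n).
Proof.
move=> lf find lA A0 AE A'C lA'.
have A0r i : A i 0 = 0 by exact: linfun0.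
have cA i k v : A i (A k v) = A k (A i v).
  case: i => [|i]; first by rewrite !A0 A0r.
  case: k => [|k]; first by rewrite !A0 A0r.
  move: v; apply: find => [|c u v Hu Hv|e' q']; first by rewrite !A0r.
    by rewrite !lA Hu Hv.
  rewrite !AE (linfunZ (lA' i.+1)) (linfunZ (lA' k.+1)) A'C.
  by congr (f e' _); rewrite [LHS]scalerA [RHS]scalerA [in LHS]mulrC.
elim/ltn_ind: n => -[|n] IH; first exact: opexp0.
apply: (@scalerI _ _ n.+1%:R); first by rewrite pnatr_eq0.
rewrite opexp_deriv // -(linfunZ (lf e)) erecS (linfun_sum (lf e)).
apply: eq_bigr => m _; rewrite IH ?ltnS ?leq_subr // AE -(linfunZ (lf e)) scalerA.
by rewrite mulfV ?pnatr_eq0 // scale1r.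
Qed.

Section VertexOperators.
Variables (F : numClosedFieldType) (l : nat).
Notation mon := {cmonom ('I_l * nat)%type}.
Implicit Types (d : lattice l) (p q : Fock F l) (m : mon).

Definition iota_VP d : Fock F l -> VP F l :=
  mext (fun m => << ((m : fock_monom l), d) : VPbasis l >> : VP F l).

Lemma iota_VPU d m : iota_VP d << m >> = << ((m : fock_monom l), d) : VPbasis l >>.
Proof. exact: mextU. Qed.

Lemma iota_VP_linear d : linear (iota_VP d).
Proof. exact: mext_is_linear. Qed.

Lemma linext_linear f : linear (@linext F l f).
Proof. exact: mext_is_linear. Qed.

Lemma linextU f k : @linext F l f << k >> = f k.
Proof. exact: mextU. Qed.

Lemma VP_linind (P : VP F l -> Prop) : P 0 ->
  (forall c u v, P u -> P v -> P (c *: u + v)) ->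
  (forall d q, P (iota_VP d q)) -> forall v, P v.
Proof.
move=> P0 PD PU; apply: malg_linind => // -[m d].
by have := PU d << m >>; rewrite iota_VPU.
Qed.

Variables (g : lieAlgebra F) (form : g -> g -> F) (alpha lam : 'I_l -> g).

Lemma heis_linear h n : linear (heis form alpha lam h n).
Proof. exact: linext_linear. Qed.

Lemma fvarM (i : 'I_l) k m : fvar F i k * << m >> = << mmul (ucm (i, k)) m >> :> Fock F l.
Proof. exact: malgUM. Qed.

Lemma heis_neg h k d p : heis form alpha lam h (Negz k) (iota_VP d p) =
  iota_VP d (creation (@fvar F l) (fun i => form h (lam i)) k * p).
Proof.
move: p; apply: linear_malg_eq => [c p q|c p q|m].
- by rewrite iota_VP_linear heis_linear.
- by rewrite -(iota_VP_linear d) alg_mul_linear.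
rewrite iota_VPU /heis linextU creation_mul (linfun_sum (iota_VP_linear d)).
apply: eq_bigr => i _; rewrite (linfunZ (iota_VP_linear d)) fvarM iota_VPU.
by rewrite [mmul (ucm _) m]mulcmC.
Qed.

Lemma heis_pos h k d p : heis form alpha lam h (Posz k.+1) (iota_VP d p) =
  iota_VP d (annihilation (@fderiv F l) (fun i => form h (alpha i)) k p).
Proof.
have la := annihilation_linear (fun i k => @pderiv_linear F l (i, k)).
move: p; apply: linear_malg_eq => [c p q|c p q|m].
- by rewrite iota_VP_linear heis_linear.
- by rewrite la iota_VP_linear.
rewrite iota_VPU /heis linextU /annihilation (linfun_sum (iota_VP_linear d)).
apply: eq_bigr => i _; rewrite (linfunZ (iota_VP_linear d)) /fderiv (pderivU _ 1 m).
rewrite mul1r [<< (m _)%:R *g _ >>]malgU_scale (linfunZ (iota_VP_linear d)) iota_VPU.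
by rewrite [RHS]scalerA.
Qed.

Lemma Eminus_iota b n d p : Eminus form alpha lam b n (iota_VP d p) =
  iota_VP d (vexp (@fvar F l) (fun i => form (wt lam b) (lam i)) n * p).
Proof.
rewrite -erec_mul; refine (opexp_intertwine d p n iota_VP_linear VP_linind _ _ _ _ _) => [[|i]|//|i {}d {}p|i k {}p|i].
- by move=> c u v; rewrite scaler0 addr0.
- move=> c u v /=; rewrite heis_linear scalerDr scalerA [in RHS]scalerA.
  by rewrite [in RHS]mulrC.
(* In E^- the sign cancels: -1/(-n) = 1/n. *)
- rewrite (linfunZ (iota_VP_linear d)) -heis_neg /=.
  by rewrite invrN opprK.
- exact: mulrCA.
- exact: alg_mul_linear.
Qed.

Lemma Eplus_iota b n d p : Eplus form alpha lam b n (iota_VP d p) =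
  iota_VP d (vderiv (@fderiv F l) (fun i => form (wt lam b) (alpha i)) p n).
Proof.
have la := annihilation_linear (fun i k => @pderiv_linear F l (i, k)).
refine (opexp_intertwine d p n iota_VP_linear VP_linind _ _ _ _ _) => [[|i]|//|i {}d {}p|i k {}p|i].
- by move=> c u v; rewrite scaler0 addr0.
- move=> c u v /=; rewrite heis_linear scalerDr scalerA [in RHS]scalerA.
  by rewrite [in RHS]mulrC.
- rewrite (linfunZ (iota_VP_linear d)) -scaleN1r (linfunZ (iota_VP_linear d)) -heis_pos /=.
  by rewrite scaleN1r scalerN scaleNr.
- apply: (opp_commute (la _ i) (la _ k)) => q; apply: annihilationC => *.
    exact: pderiv_linear.
  exact: pderivC.
- exact: opp_linear.
Qed.

Variable eps : lattice l -> lattice l -> F.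

Definition vexpz a (z : int) : Fock F l :=
  if z is Posz n then vexp (@fvar F l) a n else 0.

(** The mode m is the coefficient of x^(-m-1). With x^i from E^-, x^(-j) from E^+ and x^t from x^c,
    this forces i = z + j for z = -1-t-m; the weight k of p bounds j. *)
Lemma Ymode_iota c (z t m : int) d p k : homog k p ->
  pairP form lam c d = t%:~R -> m = (- 1 - t - z)%R ->
  Ymode form alpha lam eps c m (iota_VP d p) =
  eps c d *: iota_VP (c + d) (\sum_(j < k.+1)
    vexpz (fun i => form (wt lam c) (lam i)) (z + Posz j) *
    vderiv (@fderiv F l) (fun i => form (wt lam c) (alpha i)) p j).
Proof.
move=> hp ct mE; set a := fun i => form _ (lam i); set b := fun i => form _ (alpha i).
have lv j : linear (fun p => vderiv (@fderiv F l) b p j).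
  by apply: vderiv_linear => i k'; apply: pderiv_linear.
have lY : linear (Ymode form alpha lam eps c m) by exact: linext_linear.
have lR : linear (fun p => \sum_(j < k.+1) vexpz a (z + Posz j) *
    vderiv (@fderiv F l) b p j).
  by apply: linear_sum => j; apply: linear_comp (lv j); apply: alg_mul_linear.
move: p hp; apply: supported_linear_eq => [||mu muk].
- exact: linear_comp lY (iota_VP_linear d).
- exact: linear_scale (linear_comp (iota_VP_linear (c + d)) lR).
rewrite iota_VPU /Ymode /Ycoef linextU /= ct.
set p := (<< mu >> : Fock F l).
have hp : homog k p by apply: supportedU.
have eopE : eop eps c << ((mu : fock_monom l), d) : VPbasis l >> = iota_VP (c + d) (eps c d *: p).
  by rewrite /eop linextU (linfunZ (iota_VP_linear _)) iota_VPU.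
have E i j : Eminus form alpha lam c i (Eplus form alpha lam c j
    (eop eps c << ((mu : fock_monom l), d) : VPbasis l >>)) =
  eps c d *: iota_VP (c + d) (vexp (@fvar F l) a i * vderiv (@fderiv F l) b p j).
  rewrite eopE Eplus_iota Eminus_iota.
  have lf := linear_comp (iota_VP_linear (c + d))
    (linear_comp (alg_mul_linear (vexp (@fvar F l) a i)) (lv j)).
  exact: (linfunZ lf).
rewrite (@fsbig_antidiagonal _ _ _ z t _ k); first last.
- by rewrite mE !rmorphB rmorphN /=; ring.
- move=> [i j] /= kj; rewrite E (homog_vderiv_gt _ kj hp) mulr0.
  by rewrite (linfun0 (iota_VP_linear _)) scaler0.
rewrite (linfun_sum (iota_VP_linear _)) scaler_sumr; apply: eq_bigr => j _.
case: (z + Posz j) => [i|i] /=; first exact: E.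
by rewrite mul0r (linfun0 (iota_VP_linear _)) scaler0.
Qed.

End VertexOperators.

(** * Generation of the principal subspace *)

Section FockColor.
Variables (F : numFieldType) (l : nat).
Implicit Types (p : Fock F l) (c : 'I_l -> nat).

Lemma fock_vderiv_colorfilt b c p n : colorfilt (@fvar F l) c p ->
  colorfilt (@fvar F l) c (vderiv (@fderiv F l) b p n).
Proof.
apply: colorfilt_vderiv => *.
- exact: pderiv_linear.
- exact: pderivM.
- exact: pderivX.
Qed.

End FockColor.

Section RootVectors.
Variables (l : nat) (M : 'M[int]_l).
Implicit Types (c : 'I_l -> nat).

(* The coordinates of \sum_i c_i alpha_i with respect to the fundamental
   weights. *)
Definition rootvec c : lattice l := (\row_j Posz (c j)) *m M.

Lemma rootvecE c k : rootvec c 0 k = \sum_j Posz (c j) * M j k.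
Proof. by rewrite mxE; apply: eq_bigr => j _; rewrite mxE. Qed.

Lemma rootvecD c d : rootvec (fun j => c j + d j)%N = rootvec c + rootvec d.
Proof.
rewrite -mulmxDl; congr (_ *m _); apply/rowP => j; rewrite !mxE.
by rewrite PoszD.
Qed.

Lemma eq_rootvec c d : c =1 d -> rootvec c = rootvec d.
Proof. by move=> cd; congr (_ *m _); apply/rowP => j; rewrite !mxE cd. Qed.

Lemma rootvec0 : rootvec (fun=> 0%N) = 0.
Proof. by apply/rowP => k; rewrite rootvecE mxE big1 // => j _; rewrite mul0r. Qed.

End RootVectors.

Section Generation.
Variables (F : numClosedFieldType) (l : nat) (g : lieAlgebra F).
Variables (form : g -> g -> F) (alpha lam : 'I_l -> g) (M : 'M[int]_l).
Variables (eps : lattice l -> lattice l -> F).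
Hypothesis form_root_lam : forall c i,
  form (wt lam (rootvec M c)) (lam i) = (c i)%:R.
Hypothesis pair_root : forall c d, exists t : int,
  pairP form lam (rootvec M c) d = t%:~R.
Hypothesis eps_neq0 : forall a b, eps a b != 0.
Implicit Types (c : 'I_l -> nat) (p : Fock F l) (d : lattice l) (P : VP F l -> Prop).

Notation colorfilt := (colorfilt (@fvar F l)).
Notation hmon := (hmon (@fvar F l)).
Notation hpoly := (hpoly (@fvar F l)).

Definition lin_closed P := P 0 /\ forall a u v, P u -> P v -> P (a *: u + v).

Lemma lin_closedZ P a u : lin_closed P -> P u -> P (a *: u).
Proof. by case=> P0 PD Pu; rewrite -[_ *: _]addr0; apply: PD. Qed.

Lemma lin_closedD P u v : lin_closed P -> P u -> P v -> P (u + v).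
Proof. by case=> _ PD Pu Pv; rewrite -[u]scale1r; apply: PD. Qed.

Lemma lin_closed_cancel P u v : lin_closed P -> P (u + v) -> P v -> P u.
Proof.
move=> lP Puv Pv; rewrite -[u](addrK v) -scaleN1r; apply: lin_closedD => //.
exact: lin_closedZ.
Qed.

Lemma lin_closed_sum P (T : Type) (r : seq T) (B : pred T) (f : T -> VP F l) :
  lin_closed P -> (forall i, B i -> P (f i)) -> P (\sum_(i <- r | B i) f i).
Proof.
move=> lP H; elim/big_rec: _ => [|i u Bi Pu]; first by case: lP.
by apply: lin_closedD => //; apply: H.
Qed.

Notation cvexp c := (vexp (@fvar F l) (fun i => (c i)%:R)).
Notation cderiv c := (vderiv (@fderiv F l) (fun i => form (wt lam (rootvec M c)) (alpha i))).

Lemma Ymode_rootE c d k p (t z m : int) : homog k p ->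
  pairP form lam (rootvec M c) d = t%:~R -> m = - 1 - t - z ->
  Ymode form alpha lam eps (rootvec M c) m (iota_VP d p) =
  eps (rootvec M c) d *: iota_VP (rootvec M c + d) (\sum_(j < k.+1)
    vexpz (fun i => (c i)%:R : F) (z + Posz j) * cderiv c p j).
Proof.
move=> hp ct mE; rewrite (Ymode_iota alpha eps hp ct mE).
by have -> : (fun i => form (wt lam (rootvec M c)) (lam i)) = (fun i => (c i)%:R) by apply/funext.
Qed.

Lemma Ymode_root_colorfilt c c' d mu m : cdeg_le c' mu ->
  exists2 p, colorfilt (fun j => c j + c' j)%N p &
    Ymode form alpha lam eps (rootvec M c) m (iota_VP d (hmon mu)) =
    iota_VP (rootvec M c + d) p.
Proof.
move=> cmu; have [t tE] := pair_root c d.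
have hmu : homog (mwt mu) (hmon mu) by exact: homog_hmon.
have mE : m = - 1 - t - (- 1 - t - m) by ring.
rewrite (Ymode_rootE hmu tE mE) -(linfunZ (iota_VP_linear _)); eexists; last reflexivity.
apply: colorfiltZ; apply: colorfilt_sum => j _; apply: colorfiltM.
  case: (_ + Posz j) => n; [exact: colorfilt_vexp | exact: colorfilt0].
by apply: fock_vderiv_colorfilt; apply: colorfilt_hmon.
Qed.

(* The leading term j = 0 is the one in which E^+ acts as the identity. *)
Lemma Ymode_root_leading c d k p r : homog k p -> exists m,
  Ymode form alpha lam eps (rootvec M c) m (iota_VP d p) =
  eps (rootvec M c) d *: (iota_VP (rootvec M c + d) (cvexp c r * p) +
    \sum_(j < k) iota_VP (rootvec M c + d) (cvexp c (r + j.+1)%N * cderiv c p j.+1)).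
Proof.
move=> hp; have [t tE] := pair_root c d; exists (- 1 - t - Posz r).
rewrite (Ymode_rootE hp tE erefl) (linfun_sum (iota_VP_linear _)).
by rewrite big_ord_recl /= addn0.
Qed.

Section Closure.
Variables (P : VP F l -> Prop) (b : lattice l).
Hypothesis P_lin : lin_closed P.
Hypothesis P_gen : P (evec F b).
Hypothesis P_act : forall (j : 'I_l) m v, P v ->
  P (Ymode form alpha lam eps (rootvec M (fun i => i == j : nat)) m v).

(** Outer induction on the number \sum_i c_i of simple roots: a monomial of T_c is h_(j,r) times an
    element of T_c', with c' one smaller in color j, and the multiplication by h_(j,r) is extracted
    from a mode of the simple root alpha_j. *)
Lemma colorfilt_closure c p : colorfilt c p -> P (iota_VP (b + rootvec M c) p).
Proof.
have [N] := ubnP (\sum_i c i)%N; elim: N c p => // N IHN c p; rewrite ltnS => le.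
have hmonP : (forall mu, cdeg_le c mu -> P (iota_VP (b + rootvec M c) (hmon mu))) ->
    colorfilt c p -> P (iota_VP (b + rootvec M c) p).
  move=> H; move: p; apply: colorfilt_ind => [|a p q Pp Pq|//].
    by rewrite (linfun0 (iota_VP_linear _)); case: P_lin.
  by rewrite iota_VP_linear; case: P_lin => _; apply.
apply: hmonP => mu cmu.
have [c0|[j cj]] := eq0_or_gt0 c.
  by rewrite (cdeg_le0 c0 cmu) (eq_rootvec M c0) rootvec0 addr0 hmon1 (iota_VPU F b mone).
pose e (i : 'I_l) : nat := i == j.
pose c' i := (c i - (i == j))%N.
have cE i : c i = (e i + c' i)%N by rewrite /c' /e; case: eqP => [->|_]; lia.
have dE : b + rootvec M c = rootvec M e + (b + rootvec M c').
  by rewrite addrCA -rootvecD (eq_rootvec M cE).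
have Pc' q : colorfilt c' q -> P (iota_VP (b + rootvec M c') q).
  apply: IHN; apply: leq_trans le; rewrite (bigD1 j) //= [X in (_ < X)%N](bigD1 j) //=.
  rewrite (eq_bigr c); last by move=> i ij; rewrite /c' (negPf ij) subn0.
  by rewrite /c' eqxx; lia.
suff key k q r : colorfilt c' q -> homog k q -> P (iota_VP (b + rootvec M c) (hpoly j r * q)).
  have [r [mu' [-> cmu']]] := hmon_split (@fvar F l) cmu cj.
  by apply: (key (mwt mu')); [apply: colorfilt_hmon | apply: homog_hmon].
(* Inner induction on the weight k of q, for all r at once: the corrections carry h_(j,r+s+1) times
   an element of T_c' of weight k-s-1. *)
elim/ltn_ind: k q r => k IHk q r cq hq.
have hE n : cvexp e n = hpoly j n by [].
have [m mE] := Ymode_root_leading e (b + rootvec M c') r hq.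
have PY := P_act j m (Pc' q cq); move: PY; rewrite -/e mE -dE => PY.
have {}PY := lin_closedZ (eps (rootvec M e) (b + rootvec M c'))^-1 P_lin PY.
rewrite scalerA mulVf ?eps_neq0 // scale1r in PY.
apply: (lin_closed_cancel P_lin PY).
apply: lin_closed_sum => // s _.
rewrite hE; apply: (IHk (k - s.+1)%N).
- by have := ltn_ord s; lia.
- exact: fock_vderiv_colorfilt.
- by apply: homog_vderiv_le hq; have := ltn_ord s.
Qed.

End Closure.

End Generation.

(** * Description of the principal subspace *)

Section RootData.
Variables (F : numClosedFieldType) (g : lieAlgebra F) (H : {vspace g}).
Variables (form : g -> g -> F) (l : nat) (alpha lam : 'I_l -> g) (M : 'M[int]_l).
Hypothesis hform : invariant_form form.
Hypothesis hnorm : forall a, lie_root H form a -> form a a = 2.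
Hypothesis halpha : simple_roots H form alpha.
Hypothesis hM : is_cartan_matrix form alpha M.
Hypothesis hlam : fundamental_weights H form alpha lam.
Implicit Types (c : 'I_l -> nat) (b d : lattice l).

Lemma form_linear y : linear (fun x => form x y : F^o).
Proof. by move=> a u v; rewrite (Defs.formDl hform). Qed.

Lemma form_suml (I : Type) (r : seq I) (P : pred I) (a : I -> F) (u : I -> g) y :
  form (\sum_(i <- r | P i) a i *: u i) y = \sum_(i <- r | P i) a i * form (u i) y.
Proof.
rewrite (linfun_sum (form_linear y)); apply: eq_bigr => i _.
exact: (linfunZ (form_linear y)).
Qed.

Lemma form_simple i j : form (alpha i) (alpha j) = (M i j)%:~R.
Proof.
case: halpha => _ ra _; rewrite hM (hnorm (ra j)) mulrC mulKf //.
by rewrite pnatr_eq0.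
Qed.

Lemma form_lam_simple i j : form (lam i) (alpha j) = (i == j)%:R.
Proof. by case: (hlam i). Qed.

Lemma form_wt_simple b j : form (wt lam b) (alpha j) = (b 0 j)%:~R.
Proof.
rewrite form_suml (bigD1 j) //= form_lam_simple eqxx mulr1 big1 ?addr0 // => i.
by move=> /negPf ij; rewrite form_lam_simple ij mulr0.
Qed.

Lemma simple_roots_mem j : alpha j \in H.
Proof. by case: halpha => _ ra _; case: (ra j). Qed.

Lemma simple_roots_span h : h \in H -> exists c : 'rV[F]_l, h = \sum_i c 0 i *: alpha i.
Proof.
case: halpha => bH _ _ hH; exists (\row_i coord [tuple alpha i | i < l] i h).
rewrite {1}(coord_basis bH hH); apply: eq_bigr => i _.
by rewrite mxE (nth_map i) ?size_enum_ord // nth_ord_enum.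
Qed.

(** The fundamental weights supply the inverse of the Gram matrix of the simple roots, namely the
    matrix of their own coordinates on the simple roots. *)
Lemma form_nondeg_cartan h : h \in H -> (forall j, form h (alpha j) = 0) -> h = 0.
Proof.
move=> hH h0.
pose A := \matrix_(i, j) form (alpha i) (alpha j).
have [L LE] : exists L : 'M[F]_l, forall i, lam i = \sum_k L i k *: alpha k.
  have /choice [f fE] i : exists r : 'rV[F]_l, lam i = \sum_k r 0 k *: alpha k.
    by apply: simple_roots_span; case: (hlam i).
  exists (\matrix_(i, k) f i 0 k) => i; rewrite fE.
  by apply: eq_bigr => k _; rewrite mxE.
have LA : L *m A = 1%:M.
  apply/matrixP => i j; rewrite !mxE -form_lam_simple LE form_suml.
  by apply: eq_bigr => k _; rewrite mxE.
have [c' cE] := simple_roots_span hH.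
have cA : c' *m A = 0.
  apply/rowP => j; rewrite mxE [RHS]mxE -[RHS](h0 j) [in RHS]cE form_suml.
  by apply: eq_bigr => k _; rewrite mxE.
have c'0 : c' = 0 by rewrite -[c']mulmx1 -(mulmx1C LA) mulmxA cA mul0mx.
by rewrite cE c'0 big1 // => i _; rewrite mxE scale0r.
Qed.

(** Both sides lie in [H] and have the same pairing with every simple root. *)
Lemma wt_rootvec c : wt lam (rootvec M c) = \sum_i (c i)%:R *: alpha i.
Proof.
apply/eqP; rewrite -subr_eq0; apply/eqP/form_nondeg_cartan => [|j].
  rewrite memvB //; apply: memv_suml => i _; rewrite memvZ //.
    by case: (hlam i).
  exact: simple_roots_mem.
rewrite -scaleN1r addrC (Defs.formDl hform) form_wt_simple form_suml rootvecE rmorph_sum.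
rewrite mulN1r addrC; apply/eqP; rewrite subr_eq0; apply/eqP.
by apply: eq_bigr => i _; rewrite rmorphM /= form_simple.
Qed.

Lemma wtD b d : wt lam (b + d) = wt lam b + wt lam d.
Proof.
by rewrite -big_split /=; apply: eq_bigr => i _; rewrite mxE rmorphD scalerDl.
Qed.

Lemma form_root_lam c i : form (wt lam (rootvec M c)) (lam i) = (c i)%:R.
Proof.
rewrite wt_rootvec form_suml (bigD1 i) //= (Defs.formC hform) form_lam_simple eqxx.
rewrite mulr1 big1 ?addr0 // => j /negPf ji.
by rewrite (Defs.formC hform) form_lam_simple eq_sym ji mulr0.
Qed.

Lemma form_root_wt c d :
  form (wt lam (rootvec M c)) (wt lam d) = \sum_i (c i)%:R * (d 0 i)%:~R.
Proof.
rewrite wt_rootvec form_suml; apply: eq_bigr => i _.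
by rewrite (Defs.formC hform) form_wt_simple.
Qed.

Lemma pair_root c d : exists t : int, pairP form lam (rootvec M c) d = t%:~R.
Proof.
exists (\sum_i Posz (c i) * d 0 i); rewrite /pairP form_root_wt rmorph_sum.
by apply: eq_bigr => i _; rewrite rmorphM.
Qed.

Lemma rootvec_inj c c' : rootvec M c = rootvec M c' -> c =1 c'.
Proof.
move=> cd i; apply/eqP; rewrite -(eqr_nat F) -!form_root_lam.
by rewrite cd.
Qed.

Variables (s : nat) (eps : lattice l -> lattice l -> F).
Hypothesis hs : (0 < s)%N.
Hypothesis heps : cocycle eps s.

Lemma eps_neq0 a b : eps a b != 0.
Proof.
apply/eqP => e0; have := eps_root heps a b; rewrite e0 expr0n gtn_eqF //.
by move/eqP; rewrite eq_sym oner_eq0.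
Qed.

Variables (rho : g -> int -> VP F l -> VP F l) (x : g -> g).
Hypothesis hrho : affine_module form rho.
Hypothesis hx : normalized_root_vectors form alpha lam eps H rho x.

Lemma rho_simple j m v :
  rho (x (alpha j)) m v = Ymode form alpha lam eps (rootvec M (fun i => i == j : nat)) m v.
Proof.
have aE : alpha j = wt lam (rootvec M (fun i => i == j : nat)).
  rewrite wt_rootvec (bigD1 j) //= eqxx scale1r big1 ?addr0 // => i /negPf ->.
  by rewrite scale0r.
case: hx => _ xY; rewrite {1}aE xY // -aE.
by case: halpha.
Qed.

Lemma nplus_simple j : nplus H form alpha x (x (alpha j)).
Proof.
exists [:: alpha j].
  move=> a; rewrite inE => /eqP ->; split; first by case: halpha.
  exists (fun i => i == j : nat).
  rewrite (bigD1 j) //= eqxx scale1r big1 ?addr0 // => i /negPf ->.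
  by rewrite scale0r.
by exists (fun=> 1); rewrite big_seq1 scale1r.
Qed.

Lemma rho_linear m v : linear (fun y => rho y m v).
Proof. by move=> a y z; rewrite (rhoDl hrho). Qed.

Lemma rho_nplus (P : VP F l -> Prop) y m v : lin_closed P ->
  (forall c, P (Ymode form alpha lam eps (rootvec M c) m v)) ->
  nplus H form alpha x y -> P (rho y m v).
Proof.
move=> lP PY [r rpos [a ->]]; rewrite (linfun_sum (rho_linear m v)) big_seq_cond.
apply: lin_closed_sum => // b; rewrite andbT => /rpos [rb [c bE]].
rewrite (linfunZ (rho_linear m v)); apply: lin_closedZ => //.
rewrite bE -wt_rootvec; case: hx => _ ->; first exact: PY.
by rewrite wt_rootvec -bE.
Qed.

Notation mon := {cmonom ('I_l * nat)%type}.
Notation hmon := (hmon (@fvar F l)).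

(** Indexed by all pairs, since the independence holds for all of them; the color bound is kept
    apart in [prin_index] as a condition on supports. *)
Definition prin_vec b (k : mon * 'rV[nat]_l) : VP F l :=
  iota_VP (b + rootvec M (k.2 0)) (hmon k.1).

Definition prin_index (k : mon * 'rV[nat]_l) : Prop := cdeg_le (k.2 0) k.1.

Definition prin_span b (v : VP F l) : Prop :=
  exists2 q, v = mext (prin_vec b) q & supported prin_index q.

Lemma prin_span_closed b : lin_closed (prin_span b).
Proof.
split; first by exists 0; [rewrite raddf0 | apply: supported0].
move=> a _ _ [q -> hq] [q' -> hq']; exists (a *: q + q'); first by rewrite linearP.
by apply: supportedD => //; apply: supportedZ.
Qed.

Lemma prin_span_colorfilt b c p : colorfilt (@fvar F l) c p ->
  prin_span b (iota_VP (b + rootvec M c) p).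
Proof.
have lP := prin_span_closed b.
move: p; apply: colorfilt_ind => [|a p q Pp Pq|m cm].
- by rewrite (linfun0 (iota_VP_linear _)); case: lP.
- by rewrite iota_VP_linear; case: lP => _; apply.
pose n : 'rV[nat]_l := \row_j c j.
have nE : n 0 =1 c by move=> j; rewrite mxE.
exists << (m, n) >>; first by rewrite mextU /prin_vec /= (eq_rootvec M nE).
by apply: supportedU => j; rewrite nE.
Qed.

(** One inclusion is the stability of the span under all positive roots, the other the closure lemma
    applied to the submodule, in which the simple root vectors act. *)
Lemma principal_subspaceP b v :
  principal_subspace rho (nplus H form alpha x) (evec F b) v <-> prin_span b v.
Proof.
have lP := prin_span_closed b; split.
  elim=> [|a u w _ Pu _ Pw|y m w ny _ [q -> hq]].
  - have := prin_span_colorfilt b (colorfilt1 (@fvar F l) (fun=> 0%N)).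
    by rewrite rootvec0 addr0 (iota_VPU F b mone).
  - by case: lP => _; apply.
  apply: rho_nplus ny => // c; have lY : linear (Ymode form alpha lam eps (rootvec M c) m).
    exact: linext_linear.
  move: q hq; apply: supported_ind => [|a q q' Hq Hq'|[mu n] kn].
  - by rewrite raddf0 (linfun0 lY); case: lP.
  - by rewrite mext_is_linear lY; case: lP => _; apply.
  rewrite mextU /prin_vec /=.
  have [p cp ->] := Ymode_root_colorfilt alpha eps form_root_lam pair_root c
    (b + rootvec M (n 0)) m kn.
  by rewrite addrCA -rootvecD; apply: prin_span_colorfilt.
have lW : lin_closed (principal_subspace rho (nplus H form alpha x) (evec F b)).
  split=> [|a u w Pu Pw]; last exact: ps_lin.
  (* The zero vector is obtained as -v0 + v0. *)
  rewrite -(addNr (evec F b)) -scaleN1r; apply: ps_lin; exact: ps_gen.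
move=> [q -> hq]; move: q hq; apply: supported_ind => [|a q q' Hq Hq'|[mu n] kn].
- by rewrite raddf0; case: lW.
- by rewrite mext_is_linear; case: lW => _; apply.
rewrite mextU /prin_vec /=.
apply: (colorfilt_closure (alpha := alpha) form_root_lam pair_root eps_neq0 lW) => //.
- exact: ps_gen.
- move=> j m w Pw; rewrite -rho_simple; apply: ps_act => //; exact: nplus_simple.
- exact: colorfilt_hmon.
Qed.

End RootData.

(** * Weight spaces *)

Section Dimension.
Variables (F : numClosedFieldType) (l : nat).

Lemma sum_delta_scale d (b : 'I_d -> VP F l) i :
  \sum_j (delta_mx 0 i : 'rV[F]_d) 0 j *: b j = b i.
Proof.
rewrite (bigD1 i) //= mxE !eqxx scale1r big1 ?addr0 // => j /negPf ji.
by rewrite mxE ji andbF scale0r.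
Qed.

(** By uniqueness of coordinates the two matrices of base change satisfy A B = 1, so A, with d'
    columns, has rank d. Hence the choice made in [dimension] is forced. *)
Lemma has_dim_leq (S : set (VP F l)) d d' : has_dim S d -> has_dim S d' -> (d <= d')%N.
Proof.
move=> [b [Sb bU]] [b' [Sb' b'U]].
have Sbi i : S (b i) by rewrite -(sum_delta_scale b i); apply: Sb.
have Sb'i i : S (b' i) by rewrite -(sum_delta_scale b' i); apply: Sb'.
have /choice [f fE] i : exists c : 'rV[F]_d', b i = \sum_j c 0 j *: b' j.
  by have [c [cE _]] := b'U _ (Sbi i); exists c.
have /choice [f' f'E] i : exists c : 'rV[F]_d, b' i = \sum_j c 0 j *: b j.
  by have [c [cE _]] := bU _ (Sb'i i); exists c.
pose A := \matrix_(i, j) f i 0 j; pose B := \matrix_(i, j) f' i 0 j.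
suff AB : A *m B = 1%:M.
  by rewrite -(mxrank1 F d) -AB; apply: leq_trans (mxrankM_maxl _ _) (rank_leq_col _).
apply/row_matrixP => i; rewrite row1.
have [c [_ cU]] := bU _ (Sbi i); rewrite -(cU (delta_mx 0 i)) ?sum_delta_scale //.
symmetry; apply: cU; rewrite {1}fE.
transitivity (\sum_j \sum_k (A i j * B j k) *: b k).
  apply: eq_bigr => j _; rewrite f'E scaler_sumr; apply: eq_bigr => k _.
  by rewrite scalerA !mxE.
rewrite exchange_big; apply: eq_bigr => k _; rewrite !mxE scaler_suml.
by apply: eq_bigr.
Qed.

Lemma dimensionE (S : set (VP F l)) d : has_dim S d -> dimension S = d.
Proof.
move=> hd; rewrite /dimension; case: xgetP => [d' _ hd'|/(_ d)//].
by apply/eqP; rewrite eqn_leq (has_dim_leq hd' hd) (has_dim_leq hd hd').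
Qed.

Lemma has_dim_mext (K : choiceType) (f : K -> VP F l) (S : set (VP F l)) (s : seq K) :
  (forall q, mext f q = 0 -> q = 0) -> uniq s ->
  (forall v, S v <-> exists2 q, v = mext f q & supported (fun k => k \in s) q) ->
  has_dim S (size s).
Proof.
move=> f_inj us SE; pose t := in_tuple s; exists (fun i => f (tnth t i)).
have tinj : injective (tnth t) by apply/tuple_uniqP.
pose q0 (c : 'rV[F]_(size s)) : {malg F[K]} := \sum_i c 0 i *: << tnth t i >>.
have q0E (c : 'rV[F]_(size s)) : \sum_i c 0 i *: f (tnth t i) = mext f (q0 c).
  rewrite raddf_sum; apply: eq_bigr => i _.
  by rewrite /= (linfunZ (mext_is_linear f)) mextU.
have q0c (c : 'rV[F]_(size s)) i : (q0 c)@_(tnth t i) = c 0 i.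
  rewrite raddf_sum (bigD1 i) //= mcoeffZ mcoeffUU mulr1 big1 ?addr0 // => j /negPf ji.
  by rewrite mcoeffZ mcoeffU (inj_eq tinj) ji mulr0.
split=> [c|v /SE [q -> qs]].
  rewrite q0E; apply/SE; exists (q0 c) => //.
  apply: supported_sum => i _; apply: supportedZ; apply: supportedU; exact: (mem_tnth i t).
exists (\row_i q@_(tnth t i)); split.
  rewrite q0E; congr (mext f _); apply/malgP => k.
  have [ks|ks] := boolP (k \in s).
    have /tnthP [i ->] : k \in t by []. 
    by rewrite q0c mxE.
  rewrite !mcoeff_outdom //; last by apply: contra ks => /qs.
  apply: contra ks => kq; suff : supported (fun k => k \in s) (q0 (\row_i q@_(tnth t i))) by apply.
  apply: supported_sum => i _; apply: supportedZ; apply: supportedU; exact: (mem_tnth i t).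
move=> c; rewrite q0E => qE; apply/rowP => i; rewrite mxE -q0c.
suff -> : q = q0 c by [].
apply/eqP; rewrite -subr_eq0; apply/eqP/f_inj.
by rewrite raddfB /= qE subrr.
Qed.

End Dimension.

Lemma mext_diag_coef (F : fieldType) (K : choiceType) (e : K -> F) (q : {malg F[K]}) k :
  (mext (fun k => e k *: << k >> : {malg F[K]}) q)@_k = e k * q@_k.
Proof.
elim/malg_linind: q => [|c u v Hu Hv|k']; first by rewrite raddf0 !mcoeff0 mulr0.
  rewrite mext_is_linear !mcoeffD !mcoeffZ Hu Hv; ring.
by rewrite mextU mcoeffZ mcoeffU; case: eqVneq => [->//|_]; rewrite !mulr0.
Qed.

Lemma mext_slice_coef (F : fieldType) (K K' : choiceType) (q : {malg F[(K * K')%type]}) k k' :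
  (mext (fun u => if u.2 == k' then << u.1 >> else 0 : {malg F[K]}) q)@_k = q@_(k, k').
Proof.
elim/malg_linind: q => [|c u v Hu Hv|[m n]]; first by rewrite raddf0 !mcoeff0.
  by rewrite mext_is_linear !mcoeffD !mcoeffZ Hu Hv.
rewrite mextU /= mcoeffU xpair_eqE; case: (n == k').
  by rewrite mcoeffU andbT.
by rewrite mcoeff0 andbF.
Qed.

(** As the family f is independent, T acts diagonally on coefficients, so an eigenvector involves
    only basis vectors of its own eigenvalue. *)
Lemma mext_eigen (F : fieldType) (K : choiceType) (V : lmodType F) (f : K -> V)
    (T : V -> V) (e : K -> F) (a : F) (q : {malg F[K]}) :
  (forall q, mext f q = 0 -> q = 0) -> linear T -> (forall k, T (f k) = e k *: f k) ->
  T (mext f q) = a *: mext f q <-> supported (fun k => e k = a) q.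
Proof.
move=> f_inj lT Tf.
have TE : T (mext f q) = mext f (mext (fun k => e k *: << k >> : {malg F[K]}) q).
  move: q; apply: linear_malg_eq => [||k].
  - exact: linear_comp lT (mext_is_linear f).
  - exact: linear_comp (mext_is_linear f) (mext_is_linear _).
  by rewrite !mextU Tf (linfunZ (mext_is_linear f)) mextU.
rewrite TE; split=> [E k kq|qa].
  have {E} : mext f (mext (fun k => e k *: << k >> : {malg F[K]}) q - a *: q) = 0.
    by rewrite raddfB /= E (linfunZ (mext_is_linear f)) subrr.
  move/f_inj/(congr1 (mcoeff k)); rewrite mcoeffB mext_diag_coef mcoeffZ mcoeff0.
  move/eqP; rewrite -mulrBl mulf_eq0 subr_eq0 => /orP [/eqP //|].
  by rewrite mcoeff_eq0 kq.
rewrite -(linfunZ (mext_is_linear f)); congr (mext f _); apply/malgP => k.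
rewrite mext_diag_coef mcoeffZ; have [kq|kq] := boolP (k \in msupp q).
  by rewrite (qa k kq).
by rewrite !(mcoeff_outdom kq) !mulr0.
Qed.

Section PrincipalWeights.
Variables (F : numClosedFieldType) (l : nat) (M : 'M[int]_l).
Hypothesis rootvec_injective : forall c d, rootvec M c = rootvec M d -> c =1 d.
Notation mon := {cmonom ('I_l * nat)%type}.
Notation hmon := (hmon (@fvar F l)).

(** Distinct n give distinct lattice points b + \sum_j n_j alpha_j, so projecting onto one component
    M(1) (x) e^d isolates one n; there the h-monomials are independent. *)
Lemma prin_vec_inj b (q : {malg F[(mon * 'rV[nat]_l)%type]}) :
  mext (prin_vec F M b) q = 0 -> q = 0.
Proof.
move=> q0; apply/malgP => -[m n]; rewrite mcoeff0.
pose slice : {malg F[(mon * 'rV[nat]_l)%type]} -> {malg F[mon]} :=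
  mext (fun k => if k.2 == n then << k.1 >> else 0).
suff E : slice q = 0.
  by have := mext_slice_coef q m n; rewrite -/slice -/(slice q) E mcoeff0.
apply: (hmon_inj (F := F)).
pose d := b + rootvec M (n 0).
pose proj : VP F l -> Fock F l :=
  mext (fun k : VPbasis l => if k.2 == d then << (k.1 : mon) >> : Fock F l else 0).
have lproj : linear proj by exact: mext_is_linear.
have projE d' p : proj (iota_VP d' p) = if d' == d then p else 0.
  move: p; apply: linear_malg_eq => [||m'].
  - exact: linear_comp lproj (iota_VP_linear d').
  - by case: (d' == d) => c u v //; rewrite scaler0 addr0.
  by rewrite iota_VPU /proj mextU.
have <- : proj (mext (prin_vec F M b) q) = mext hmon (slice q).
  move: q {q0}; apply: linear_malg_eq => [||[m' n']].
  - exact: linear_comp lproj (mext_is_linear _).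
  - exact: linear_comp (mext_is_linear hmon) (mext_is_linear _).
  rewrite mextU /prin_vec projE /slice mextU /=.
  rewrite [b + _ == d](inj_eq (addrI b)).
  have -> : (rootvec M (n' 0) == rootvec M (n 0)) = (n' == n).
    apply/eqP/eqP => [/rootvec_injective E|->//]; apply/rowP => j; exact: E.
  by case: (n' == n); rewrite ?mextU ?raddf0.
by rewrite q0 (linfun0 lproj).
Qed.

Variables (g : lieAlgebra F) (form : g -> g -> F) (alpha lam : 'I_l -> g).

Lemma heis0_iota h d p :
  heis form alpha lam h 0 (iota_VP d p) = form h (wt lam d) *: iota_VP d p.
Proof.
move: p; apply: linear_malg_eq => [||m].
- exact: linear_comp (@heis_linear F l g form alpha lam h 0) (iota_VP_linear d).
- exact: linear_scale (iota_VP_linear d).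
by rewrite iota_VPU /heis linextU.
Qed.

Lemma L0_iota d p k : homog k p ->
  L0 form lam (iota_VP d p) = (k%:R + pairP form lam d d / 2) *: iota_VP d p.
Proof.
move: p; apply: supported_linear_eq => [||m <-].
- exact: linear_comp (linext_linear _) (iota_VP_linear d).
- exact: linear_scale (iota_VP_linear d).
by rewrite iota_VPU /L0 linextU.
Qed.

Variable b : lattice l.
Hypothesis form_lam_wt : forall (n : 'rV[nat]_l) j,
  form (lam j) (wt lam (b + rootvec M (n 0))) = form (lam j) (wt lam b) + (n 0 j)%:R.

Definition prin_energy (n : 'rV[nat]_l) : F :=
  pairP form lam (b + rootvec M (n 0)) (b + rootvec M (n 0)) / 2.

Variable W : set (VP F l).
Hypothesis WE : forall v, W v <-> prin_span M b v.

Lemma prin_weight_space (mu : 'rV[F]_l) N (s : seq (mon * 'rV[nat]_l)%type) : uniq s ->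
  (forall k, k \in s <-> [/\ prin_index k,
     N = (mwt k.1)%:R + prin_energy k.2 &
     forall j, mu 0 j = form (lam j) (wt lam b) + (k.2 0 j)%:R]) ->
  has_dim (weight_space form alpha lam W mu N) (size s).
Proof.
move=> us sE; apply: (has_dim_mext (@prin_vec_inj b)) => // v.
have hH j k : heis form alpha lam (lam j) 0 (prin_vec F M b k) =
    (form (lam j) (wt lam b) + (k.2 0 j)%:R) *: prin_vec F M b k.
  by rewrite heis0_iota form_lam_wt.
have hL k : L0 form lam (prin_vec F M b k) =
    ((mwt k.1)%:R + prin_energy k.2) *: prin_vec F M b k.
  by apply: L0_iota; apply: homog_hmon.
have eL a q := mext_eigen a q (@prin_vec_inj b) (linext_linear _) hL.
have eH a j q := mext_eigen a q (@prin_vec_inj b)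
  (@heis_linear F l g form alpha lam (lam j) 0) (hH j).
split=> [[/WE [q -> qi] /eL qL qH]|[q -> qs]].
  exists q => // k kq; apply/sE; split; first exact: qi.
    by rewrite (qL _ kq).
  by move=> j; have /eH/(_ _ kq) -> := qH j.
split.
- by apply/WE; exists q => // k /qs /sE [].
- by apply/eL => k /qs /sE [].
- by move=> j; apply/eH => k /qs /sE [_ _ ->].
Qed.

End PrincipalWeights.

(** * Counting partitions *)

Section InverseSeries.
Variable F : fieldType.
Implicit Types (p q : {poly F}).

Lemma inv_coef_unique p (f : nat -> F) : p`_0 != 0 ->
  (forall k, \sum_(j < k.+1) p`_(k - j) * f j = (k == 0%N)%:R) -> f =1 inv_coef p.
Proof.
move=> p0 fE k; elim/ltn_ind: k => k IH.
have := inv_coefP k p0; rewrite -(fE k) !big_ord_recr /= subnn.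
have -> : \sum_(j < k) p`_(k - j) * inv_coef p j = \sum_(j < k) p`_(k - j) * f j.
  by apply: eq_bigr => j _; rewrite IH.
by move/addrI/(mulfI p0).
Qed.

Lemma inv_coef1 k : inv_coef (1 : {poly F}) k = (k == 0%N)%:R.
Proof.
apply/esym; move: k; apply: inv_coef_unique => [|k]; first by rewrite coef1 oner_eq0.
rewrite big_ord_recr /= subnn coef1 mul1r big1 ?add0r // => j _.
by rewrite coef1 subn_eq0 leqNgt ltn_ord mul0r.
Qed.

(** With q = p (1 - X^N), this is the identity 1/q = 1/p + X^N / q. *)
Lemma inv_coef_mul p N k : p`_0 != 0 -> (0 < N)%N ->
  inv_coef (p * (1 - 'X^N)) k =
  inv_coef p k + (if (N <= k)%N then inv_coef (p * (1 - 'X^N)) (k - N) else 0).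
Proof.
move=> p0 N0; set q := p * _; pose f k := if (N <= k)%N then inv_coef q (k - N) else 0.
have q0 : q`_0 != 0.
  by rewrite /q mulrBr mulr1 coefB coefMXn N0 subr0.
suff /(_ k) <- : (fun k => inv_coef q k - f k) =1 inv_coef p by rewrite subrK.
apply: inv_coef_unique => // {}k.
(* A polynomial truncation of 1/q, exact up to degree k, so that the identity is checked by
   multiplying polynomials. *)
pose I := \poly_(j < k.+1) inv_coef q j.
transitivity ((p * (I * (1 - 'X^N)))`_k).
  rewrite coefMr; apply: eq_bigr => j _; congr (_ * _).
  have jk := ltn_ord j.
  rewrite mulrBr mulr1 coefB coefMXn !coef_poly jk /f; case: leqP => // Nj.
  by rewrite (leq_ltn_trans (leq_subr _ _)).
rewrite mulrCA mulrC -/q coefMr -(inv_coefP k q0); apply: eq_bigr => j _.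
by rewrite coef_poly ltn_ord.
Qed.

Lemma qpoch_coef0 n : (qpoch F n)`_0 = 1.
Proof.
rewrite -horner_coef0 horner_prod big_nat big1 // => k /andP [k0 _].
by rewrite !hornerE expr0n (gtn_eqF k0) subr0.
Qed.

Lemma prod_qpoch_coef0 l (n : 'I_l -> nat) : (\prod_j qpoch F (n j))`_0 != 0.
Proof.
rewrite -horner_coef0 horner_prod big1 ?oner_eq0 // => j _.
by rewrite horner_coef0 qpoch_coef0.
Qed.

Lemma qpochS n : qpoch F n.+1 = qpoch F n * (1 - 'X^(n.+1)).
Proof. by rewrite /qpoch big_nat_recr. Qed.

Lemma prod_qpoch_split l (n : 'I_l -> nat) j : (0 < n j)%N ->
  \prod_i qpoch F (n i) =
  (\prod_i qpoch F (n i - (i == j))) * (1 - 'X^(n j)).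
Proof.
move=> nj; rewrite (bigD1 j) //= [X in _ = X * _](bigD1 j) //= eqxx subn1.
rewrite -{1}(prednK nj) qpochS (prednK nj) mulrAC; congr (_ * _ * _).
by apply: eq_bigr => i /negPf ->; rewrite subn0.
Qed.

End InverseSeries.

(** * Images of monomials under maps of variables *)

Section MonomialPush.
Variable I : choiceType.
Implicit Types (m : {cmonom I}) (u v : I) (w : I -> nat).

Definition mpow m c : {cmonom I} := iter c (mmul m) mone.

Lemma cmwt_mpow w m c : cmwt w (mpow m c) = (c * cmwt w m)%N.
Proof. by elim: c => [|c IH]; rewrite ?cmwt1 //= cmwtM IH mulSn. Qed.

Lemma mpowD m c d : mpow m (c + d) = mmul (mpow m c) (mpow m d).
Proof.
elim: c => [|c IH]; first exact/esym/mul0cm.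
by rewrite addSn /= IH; exact: mulcmA.
Qed.

Definition mpush (f : I -> I) m : {cmonom I} :=
  \big[mmul/mone]_(v <- finsupp (cmonom_val m)) mpow (ucm (f v)) (m v).

Lemma mpush1 f : mpush f mone = mone.
Proof. by rewrite /mpush mdom1 big_seq_fset0. Qed.

Lemma mpushU f v : mpush f (ucm v) = ucm (f v).
Proof. rewrite /mpush mdomU big_seq_fset1 cmUU; exact: mulcm0. Qed.

Lemma mpush_widen f m (d : {fset I}) : (finsupp (cmonom_val m) `<=` d)%fset ->
  mpush f m = \big[mmul/mone]_(v <- d) mpow (ucm (f v)) (m v).
Proof.
move=> le; rewrite /mpush (big_fset_incl _ le) // => v _.
by rewrite memNfinsupp => /eqP ->.
Qed.

Lemma mpushM f m m' : mpush f (mmul m m') = mmul (mpush f m) (mpush f m').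
Proof.
pose d := (finsupp (cmonom_val m) `|` finsupp (cmonom_val m'))%fset.
rewrite !(@mpush_widen f _ d) ?mdomD ?fsubset_refl ?fsubsetUl ?fsubsetUr //.
by rewrite -big_split /=; apply: eq_bigr => v _; rewrite cmM mpowD.
Qed.

Lemma cmwt_mpush w f m : cmwt w (mpush f m) = cmwt (w \o f) m.
Proof.
elim/cmonom_ind: m => [|v m IH]; first by rewrite mpush1 !cmwt1.
by rewrite mpushM !cmwtM mpushU !cmwtU IH.
Qed.

Lemma cmwt_pred1 m u : cmwt (fun v => v == u : nat) m = m u.
Proof.
elim/cmonom_ind: m => [|v m IH]; first by rewrite cmwt1 cm1.
by rewrite cmwtM cmwtU IH cmM cmU.
Qed.

Lemma eq_cmwt w w' m : w =1 w' -> cmwt w m = cmwt w' m.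
Proof. by move=> ww'; apply: eq_bigr => v _; rewrite ww'. Qed.

Lemma cmwtD w w' m : cmwt (fun v => w v + w' v)%N m = (cmwt w m + cmwt w' m)%N.
Proof. by rewrite -big_split /=; apply: eq_bigr => v _; rewrite mulnDl. Qed.

End MonomialPush.

Section Counting.
Variables (F : fieldType) (l : nat).
Notation var := ('I_l * nat)%type.
Notation mon := {cmonom var}.
Implicit Types (m : mon) (n : 'I_l -> nat) (j : 'I_l).

Definition raise_var j (v : var) : var := (v.1, v.2 + (v.1 == j))%N.

Lemma raise_var_inj j : injective (raise_var j).
Proof.
move=> [i k] [i' k'] [-> /eqP]; rewrite eqn_add2r => /eqP -> //.
Qed.

(* A monomial of degree at most N in the color j is a partition with at most N
   parts in that color; this adds 1 to each of its N parts. *)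
Definition raise_parts j N m : mon :=
  mmul (mpush (raise_var j) m) (mpow (ucm (j, 0%N)) (N - cdeg j m)).

Lemma cdeg_raise j N m i : (cdeg j m <= N)%N ->
  cdeg i (raise_parts j N m) = if i == j then N else cdeg i m.
Proof.
move=> le; rewrite /cdeg cmwtM cmwt_mpush cmwt_mpow cmwtU /= eq_sym.
by case: eqVneq => [->|_]; rewrite ?muln1 ?muln0 ?addn0 // subnKC.
Qed.

Lemma mwt_raise j N m : (cdeg j m <= N)%N ->
  mwt (raise_parts j N m) = (mwt m + N)%N.
Proof.
move=> le; rewrite /mwt cmwtM cmwt_mpush cmwt_mpow cmwtU /= muln1.
rewrite (@eq_cmwt _ _ (fun v => v.2.+1 + (v.1 == j))%N) // cmwtD.
by rewrite -/(cdeg j m) -addnA subnKC.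
Qed.

(** The multiplicity of u in m is that of the raised variable, because the padding (j, 0) is never a
    raised variable. *)
Lemma raise_parts_inj j N : injective (raise_parts j N).
Proof.
have E m u : raise_parts j N m (raise_var j u) = m u.
  rewrite cmM -!cmwt_pred1 cmwt_mpush cmwt_mpow cmwtU /=.
  rewrite (_ : (j, 0%N) == _ = false) ?muln0 ?addn0.
    by apply: eq_cmwt => v /=; rewrite (inj_eq (@raise_var_inj j)).
  apply/negbTE; rewrite /raise_var xpair_eqE /= [u.1 == j]eq_sym.
  by case: (j == u.1); rewrite ?addn1.
by move=> m m' mm'; apply/eqP/cmP => u; rewrite -(E m) mm' E.
Qed.

(** In color j, the parts equal to 1 form the padding and the others are lowered by 1. *)
Lemma raise_parts_surj j m :
  exists m', m = mmul (mpush (raise_var j) m') (mpow (ucm (j, 0%N)) (cdeg j m - cdeg j m'))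
    /\ (cdeg j m' <= cdeg j m)%N.
Proof.
suff [m' [c mE]] : exists m' c, m = mmul (mpush (raise_var j) m') (mpow (ucm (j, 0%N)) c).
  have cE : cdeg j m = (cdeg j m' + c)%N.
    by rewrite mE /cdeg cmwtM cmwt_mpush cmwt_mpow cmwtU /= eqxx muln1.
  by exists m'; rewrite cE addKn leq_addr.
elim/cmonom_ind: m => [|[i k] m [m' [c ->]]].
  by exists mone, 0%N; rewrite mpush1 [RHS]mulcm0.
have [ij|ij] := eqVneq i j; last first.
  exists (mmul (ucm (i, k)) m'), c; rewrite mpushM mpushU /raise_var /= (negPf ij) addn0.
  exact: mulcmA.
case: k => [|k].
  exists m', c.+1; rewrite ij [in RHS]/mpow iterS -/(mpow _ c).
  by rewrite [LHS]mulcmA [X in mulcm X _]mulcmC -[LHS]mulcmA.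
exists (mmul (ucm (i, k)) m'), c; rewrite mpushM mpushU /raise_var /= ij eqxx addn1.
exact: mulcmA.
Qed.

(** Either there are fewer than n_j parts of color j, or exactly n_j, and then removing 1 from each
    leaves weight k - n_j. This is the recursion of [inv_coef_mul]; the first case lowers \sum_j
    n_j, the second k. *)
Lemma partition_count n k : exists s : seq mon, [/\ uniq s,
  forall m, (m \in s) <-> cdeg_le n m /\ mwt m = k &
  (size s)%:R = inv_coef (\prod_j qpoch F (n j)) k].
Proof.
have [N] := ubnP (\sum_j n j + k)%N; elim: N n k => // N IH n k; rewrite ltnS => le.
have [n0|[j nj]] := eq0_or_gt0 n.
- exists (if k == 0%N then [:: mone] else [::]); split.
  + by case: eqP.
  + move=> m; split=> [|[/(cdeg_le0 n0) -> <-]].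
      case: eqP => // ->; rewrite inE => /eqP ->; split; last exact: cmwt1.
      by move=> j; rewrite cdeg1.
    by rewrite mwt1 inE.
  + rewrite big1 ?inv_coef1; first by case: eqP.
    by move=> j _; rewrite n0 /qpoch big_geq.
pose n' i := (n i - (i == j))%N.
have sn : (\sum_i n i = (\sum_i n' i).+1)%N.
  have E : (\sum_(i | i != j) n' i = \sum_(i | i != j) n i)%N.
    by apply: eq_bigr => i /negPf ij; rewrite /n' ij subn0.
  rewrite (bigD1 j) //= [X in _ = X.+1](bigD1 j) //= E /n' eqxx.
  by rewrite -addSn subn1 prednK.
have [s1 [us1 s1E s1c]] : exists s : seq mon, [/\ uniq s,
    forall m, (m \in s) <-> cdeg_le n' m /\ mwt m = k &
    (size s)%:R = inv_coef (\prod_j qpoch F (n' j)) k] by apply: IH; lia.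
(* The guard [n j <= k] is needed because k - n_j is truncated: below it the second family is
   empty. *)
have [s2 [us2 s2E s2c]] : exists s : seq mon, [/\ uniq s,
    forall m, (m \in s) <-> [/\ cdeg_le n m, (n j <= k)%N & (mwt m + n j)%N = k] &
    (size s)%:R = (if (n j <= k)%N then inv_coef (\prod_j qpoch F (n j)) (k - n j) else 0)].
  case: leqP => [njk|_]; last first.
    by exists [::]; split=> // m; split=> // -[].
  have [s [us sE sc]] := IH n (k - n j)%N ltac:(lia).
  exists s; split=> // m; rewrite sE.
  by split=> [[nm mk]|[nm _ mk]]; split=> //; lia.
exists (s1 ++ map (raise_parts j (n j)) s2); split.
- rewrite cat_uniq us1 (map_inj_uniq (@raise_parts_inj j (n j))) us2 andbT /=.
  apply/hasPn => _ /mapP [m /s2E [nm _ _] ->]; apply/negP => /s1E [/(_ j)].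
  by rewrite cdeg_raise // eqxx /n' eqxx; lia.
- move=> m; rewrite mem_cat; split.
    case/orP => [/s1E [n'm mk]|/mapP [m' /s2E [nm njk mk] ->]].
      by split=> // i; apply: leq_trans (n'm i) (leq_subr _ _).
    split; last by rewrite mwt_raise.
    by move=> i; rewrite cdeg_raise //; case: eqP => [->|].
  move=> [nm mk]; have [lt|ge] := ltnP (cdeg j m) (n j).
    apply/orP; left; apply/s1E; split=> // i; rewrite /n'; have := nm i.
    by case: eqVneq => [->|_]; lia.
  have {ge} cE : cdeg j m = n j by apply/eqP; rewrite eqn_leq ge nm.
  have [m' [mE m'm]] := raise_parts_surj j m.
  rewrite cE in mE m'm.
  have mwtE : mwt m = (mwt m' + n j)%N by rewrite {1}mE -/(raise_parts j (n j) m') mwt_raise.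
  apply/orP; right; apply/mapP; exists m' => //; apply/s2E; split; try lia.
  move=> i; have := nm i; rewrite {1}mE -/(raise_parts j (n j) m') cdeg_raise //.
  by case: eqVneq => [->|_].
rewrite size_cat size_map natrD s1c s2c (prod_qpoch_split F nj).
by rewrite [RHS](inv_coef_mul _ (prod_qpoch_coef0 F _) nj).
Qed.

End Counting.

(** * Characters *)

Section FermionicEval.
Variables (F : numFieldType) (l : nat) (E : 'rV[nat]_l -> F).

Lemma map_natr_inj : injective (map_mx (fun k : nat => k%:R : F) : 'rV_l -> 'rV_l).
Proof.
move=> n n' /rowP nn'; apply/rowP => j; apply/eqP; rewrite -(eqr_nat F).
by have := nn' j; rewrite !mxE => ->.
Qed.

Lemma fermionic_term_at (n : 'rV[nat]_l) k (e : F) :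
  fermionic_term n e (map_mx (fun k => k%:R) n) (e + k%:R) =
  inv_coef (\prod_j qpoch F (n 0 j)) k.
Proof.
rewrite /fermionic_term eqxx.
rewrite (_ : [set k0 : nat | e + k%:R = e + k0%:R] = [set k]) ?fsbig_set1 //.
apply/seteqP; split=> k' /= => [/addrI/eqP|->//].
by rewrite eqr_nat => /eqP.
Qed.

(** In characteristic zero mu determines n, and then N determines k, so a single term of the double
    sum survives. *)
Lemma fermionic_sum_at (n : 'rV[nat]_l) k :
  fermionic_sum E (map_mx (fun k => k%:R) n) (E n + k%:R) =
  inv_coef (\prod_j qpoch F (n 0 j)) k.
Proof.
rewrite -(fermionic_term_at n k (E n)) /fermionic_sum.
rewrite -(@fsbig_widen _ _ _ _ [set n]) ?fsbig_set1 // => n' [_ /= nn'].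
rewrite /fermionic_term ifF //; apply/negbTE/eqP => /map_natr_inj n'n.
by apply: nn'.
Qed.

Lemma fermionic_sum_none mu N :
  (forall (n : 'rV[nat]_l) k, mu = map_mx (fun k => k%:R) n -> N <> E n + k%:R) ->
  fermionic_sum E mu N = 0.
Proof.
move=> H; rewrite /fermionic_sum fsbig1 // => n _; rewrite /fermionic_term.
by case: eqP => // /H nE; rewrite fsbig1 // => k /= /nE.
Qed.

End FermionicEval.

Section PrincipalCharacter.
Variables (F : numClosedFieldType) (g : lieAlgebra F) (H : {vspace g}).
Variables (form : g -> g -> F) (l : nat) (alpha lam : 'I_l -> g) (M : 'M[int]_l).
Hypothesis hform : invariant_form form.
Hypothesis hnorm : forall a, lie_root H form a -> form a a = 2.
Hypothesis halpha : simple_roots H form alpha.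
Hypothesis hM : is_cartan_matrix form alpha M.
Hypothesis hlam : fundamental_weights H form alpha lam.
Variables (s : nat) (eps : lattice l -> lattice l -> F).
Hypothesis hs : (0 < s)%N.
Hypothesis heps : cocycle eps s.
Variables (rho : g -> int -> VP F l -> VP F l) (x : g -> g).
Hypothesis hrho : affine_module form rho.
Hypothesis hx : normalized_root_vectors form alpha lam eps H rho x.
Implicit Types (b : lattice l) (n : 'rV[nat]_l).

Lemma quadE n : quad F M n = form (wt lam (rootvec M (n 0))) (wt lam (rootvec M (n 0))).
Proof.
rewrite (form_root_wt hform hnorm halpha hM hlam) /quad mxE rmorph_sum.
apply: eq_bigr => i _; rewrite rmorphM mulrC; congr (_ * _); first by rewrite !mxE.
congr ((_ *m M) 0 i)%:~R; apply/rowP => j; by rewrite !mxE.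
Qed.

Lemma form_wt_root b n : form (wt lam b) (wt lam (rootvec M (n 0))) =
  \sum_i (n 0 i)%:R * (b 0 i)%:~R.
Proof. by rewrite (Defs.formC hform) (form_root_wt hform hnorm halpha hM hlam). Qed.

(** The cross term <b, \sum_i n_i alpha_i> equals n_i for b = lambda_i; this is the origin of the
    summand 2 n_i in the exponent. *)
Lemma prin_energyE b n : prin_energy M form lam b n =
  form (wt lam b) (wt lam b) / 2 + (quad F M n / 2 + \sum_i (n 0 i)%:R * (b 0 i)%:~R).
Proof.
have fD u v w : form (u + v) w = form u w + form v w.
  by have := linfunD (form_linear hform w) u v.
rewrite /prin_energy /pairP wtD fD !(Defs.formC hform _ (_ + _)) !fD -quadE.
rewrite (Defs.formC hform (wt lam (rootvec M _)) (wt lam b)) form_wt_root.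
by field.
Qed.

(** Shifting by the weight of e^b treats Lambda_0 and all lambda_i together. The dimension is
    exhibited along with its value, so that finiteness comes with it. *)
Lemma principal_weight_dim b (mu : 'rV[F]_l) (N : F) :
  exists2 d, has_dim (weight_space form alpha lam
      (principal_subspace rho (nplus H form alpha x) (evec F b))
      (mu + \row_j form (lam j) (wt lam b)) (N + form (wt lam b) (wt lam b) / 2)) d &
    d%:R = fermionic_sum
      (fun n => quad F M n / 2 + \sum_i (n 0 i)%:R * (b 0 i)%:~R) mu N.
Proof.
set E := fun n => _.
have hflw (n : 'rV[nat]_l) j : form (lam j) (wt lam (b + rootvec M (n 0))) =
    form (lam j) (wt lam b) + (n 0 j)%:R.
  rewrite wtD (Defs.formC hform) (linfunD (form_linear hform _)).
  by rewrite (form_root_lam hform hnorm halpha hM hlam) (Defs.formC hform).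
have hW v := principal_subspaceP hform hnorm halpha hM hlam hs heps hrho hx b v.
have key := prin_weight_space
  (rootvec_inj hform hnorm halpha hM hlam) alpha hflw hW.
have [[n [k [-> ->]]]|none] := pselect (exists (n : 'rV[nat]_l) k, mu = map_mx (fun k => k%:R) n /\ N = E n + k%:R).
  have [r [ur rE rc]] := partition_count F (n 0) k.
  exists (size (map (fun m => (m, n)) r)); last by rewrite size_map rc fermionic_sum_at.
  apply: key => [|[m n']]; first by rewrite map_inj_uniq // => ? ? [].
  rewrite /prin_index /=; split.
    case/mapP => m' /rE [cm mk] [-> ->]; split=> //.
      by rewrite prin_energyE mk -/(E n); ring.
    by move=> j; rewrite !mxE addrC.
  case=> cm Nm muE.
  have nn' : n' = n.
    apply: (@map_natr_inj F); apply/rowP => j; have := muE j; rewrite !mxE addrC.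
    by move/addrI.
  apply/mapP; exists m; rewrite ?nn' //; apply/rE; rewrite -nn'; split=> //.
  apply/eqP; rewrite -(eqr_nat F); apply/eqP.
  move: Nm; rewrite prin_energyE nn' -/(E n) => Nm.
  by apply: (addIr (form (wt lam b) (wt lam b) / 2 + E n)); rewrite -Nm; ring.
exists 0%N; last by rewrite fermionic_sum_none // => n k nE NE; apply: none; exists n, k.
(* No basis vector has this weight: the weight space is spanned by the empty list. *)
rewrite -[0%N]/(size (Nil (prod {cmonom ('I_l * nat)%type} 'rV[nat]_l))).
apply: key => // -[m n]; split=> // -[_ /= NE muE]; case: none.
exists n, (mwt m); split.
  apply/rowP => j; have := muE j; rewrite !mxE addrC.
  by move/addrI.
move: NE; rewrite prin_energyE -/(E n) => NE.
by apply: (addIr (form (wt lam b) (wt lam b) / 2)); rewrite NE; ring.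
Qed.

Lemma principal_character_defined b : character_defined form alpha lam
  (principal_subspace rho (nplus H form alpha x) (evec F b)).
Proof.
move=> mu N.
have [d hd _] := principal_weight_dim b (mu - \row_j form (lam j) (wt lam b))
  (N - form (wt lam b) (wt lam b) / 2).
by exists d; rewrite !subrK in hd.
Qed.

Lemma principal_character b (mu : 'rV[F]_l) (N : F) :
  character form alpha lam (principal_subspace rho (nplus H form alpha x) (evec F b))
    (mu + \row_j form (lam j) (wt lam b)) (N + form (wt lam b) (wt lam b) / 2) =
  fermionic_sum (fun n => quad F M n / 2 + \sum_i (n 0 i)%:R * (b 0 i)%:~R) mu N.
Proof.
have [d hd <-] := principal_weight_dim b mu N.
by rewrite /character (dimensionE hd).
Qed.

End PrincipalCharacter.

Lemma wt_delta (F : numClosedFieldType) (g : lieAlgebra F) (l : nat) (lam : 'I_l -> g) i :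
  wt lam (delta_mx 0 i) = lam i.
Proof.
rewrite /wt (bigD1 i) //= mxE !eqxx scale1r big1 ?addr0 // => j /negPf ji.
by rewrite mxE ji andbF scale0r.
Qed.

Theorem corollary5p1 (R : realType) (g : lieAlgebra R[i]) (H : {vspace g})
    (form : g -> g -> R[i]) (l : nat) (alpha lam : 'I_l -> g) (M : 'M[int]_l)
    (s : nat) (eps : lattice l -> lattice l -> R[i])
    (rho : g -> int -> VP R[i] l -> VP R[i] l) (x : g -> g)
    (hg : lie_simple g)
    (hH : cartan_subalgebra H)
    (hform : invariant_form form)
    (hnorm : forall a, lie_root H form a -> form a a = 2)
    (halpha : simple_roots H form alpha)
    (hM : is_cartan_matrix form alpha M)
    (hADE : typeADE M)
    (hlam : fundamental_weights H form alpha lam)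
    (hs : (0 < s)%N)
    (heps : cocycle eps s)
    (hc : commutator_on_Q form alpha lam eps)
    (hrho : affine_module form rho)
    (hrhoH : rho_heis form alpha lam H rho)
    (hx : normalized_root_vectors form alpha lam eps H rho x) :
  let W b := principal_subspace rho (nplus H form alpha x) (evec R[i] b) in
  let lambda i : lattice l := delta_mx 0 i in
  let chi b := character form alpha lam (W b) in
  let chi' i := fmonmul (- \row_j form (lam i) (lam j)) (- (form (lam i) (lam i) / 2))
                  (chi (lambda i)) in
  character_defined form alpha lam (W 0) /\
  (forall i, character_defined form alpha lam (W (lambda i))) /\
  chi 0 = fermionic_sum (fun n => quad R[i] M n / 2) /\
  (forall i, chi' i =
     fermionic_sum (fun n => (quad R[i] M n + 2 * (n 0 i)%:R) / 2)).
Proof.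
move=> W lambda chi chi'.
have cd b := principal_character_defined hform hnorm halpha hM hlam hs heps hrho hx b.
have ch b mu N := principal_character hform hnorm halpha hM hlam hs heps hrho hx b mu N.
split; [exact: cd | split; [by move=> i; exact: cd | split]].
  apply/funext => mu; apply/funext => N.
  have wt0 : wt lam 0 = 0 by rewrite /wt big1 // => i _; rewrite mxE scale0r.
  have f0 y : form 0 y = 0 by have := linfun0 (form_linear hform y).
  have := ch 0 mu N; rewrite wt0 f0 mul0r addr0.
  rewrite (_ : \row_j _ = 0) ?addr0 => [chE|]; last first.
    by apply/rowP => j; rewrite !mxE (Defs.formC hform) f0.
  etransitivity; first exact: chE.
  congr (fermionic_sum _ mu N); apply/funext => n.
  by rewrite big1 ?addr0 // => i _; rewrite mxE mulr0.
(* The prefactor has negative exponents, so multiplying by it evaluates the character at arguments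
   shifted by plus the weight of e^(lambda_i). *)
move=> i; apply/funext => mu; apply/funext => N; rewrite /chi' /fmonmul !opprK.
have := ch (lambda i) mu N; rewrite wt_delta.
rewrite (_ : \row_j form (lam j) (lam i) = \row_j form (lam i) (lam j)) => [chE|]; last first.
  by apply/rowP => j; rewrite !mxE (Defs.formC hform).
etransitivity; first exact: chE.
congr (fermionic_sum _ mu N); apply/funext => n.
rewrite (bigD1 i) //= mxE !eqxx mulr1 big1 ?addr0; last first.
  by move=> j /negPf ji; rewrite mxE ji andbF mulr0.
by field.
Qed.
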